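(* Let $n\ge 1$ be an integer. The alternating group $A_n$ is $(\ast\ast)$-coverable if and only if $4\leq n\leq 8$.
   Context: For a subgroup $H$ of a group $G$ and $g\in G$, $H^g=g^{-1}Hg$. A covering of a finite group $G$ is a set of proper subgroups of $G$ whose set-theoretical union is $G$ and such that no member of the set is contained in another (different) member of the set. A finite group $G$ is called $(\ast\ast)$-coverable if there exist proper subgroups $H,K$ of $G$ such that $\delta=\{H^g,K^g: g\in G\}$ is a covering of $G$. Here $A_n$ denotes the alternating group on $\{1,\ldots,n\}$, and in the definition conjugation is by elements of $G=A_n$ itself. *)

(* Defs.v *)
From mathcomp Require Import all_boot all_fingroup all_solvable.

Set Implicit Arguments.
Unset Strict Implicit.
Unset Printing Implicit Defensive.

Local Open Scope group_scope.

Definition is_covering (gT : finGroupType) (G : {group gT})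
    (d : {set {group gT}}) : Prop :=
  [/\ {in d, forall H : {group gT}, H \proper G},
      \bigcup_(H in d) H = G
    & {in d &, forall H K : {group gT}, H \subset K -> H = K}].

Definition conjugate_subgroups (gT : finGroupType) (G H : {group gT}) :
    {set {group gT}} :=
  [set (H :^ g)%G | g in G].

Definition star_star_coverable (gT : finGroupType) (G : {group gT}) : Prop :=
  exists H K : {group gT},
    [/\ H \proper G, K \proper G
      & is_covering G (conjugate_subgroups G H :|: conjugate_subgroups G K)].

(* Main.v *)
(* Let [n >= 9] and let the conjugates of [H] and [K] cover [A_n], so that every even cycle type
   occurs in [H] or in [K].  The classes of "lying in a common 3-cycle" are blocks of a proper
   transitive group with a 3-cycle.  If [b] is their size and [l] the length of a cycle of an
   element, the blocks met by this cycle show that [r b] is a sum of cycle lengths including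
   this one, for some [r <= l]; comparing a few types, [H] and [K] are not both transitive.
   If [K] stabilizes a set of [k <= n/2] points, then [H] is transitive and
   contains every even type without partial sum [k].  Either block sizes exclude this as
   before, or [H] is 2-transitive and suitable powers of its elements are 3-cycles, double
   transpositions, 5-cycles or products of two 3-cycles, which force [H = A_n].  Only [n = 9],
   [k = 4] resists: there [H] contains both [A_9]-classes of 9-cycles, which its Sylow
   3-subgroup does not allow.
   For [4 <= n <= 8] one takes for [H] the stabilizer of a set of 1, 1, 1, 2, 3 points and for
   [K] the stabilizer of a partition 2|2, AGL(1,5), the stabilizer of a partition 3|3,
   AGL(1,7), AGL(3,2), each intersected with [A_n]. *)

Require Import Defs.
From mathcomp Require Import all_boot all_fingroup all_solvable.
From mathcomp Require Import zify.

Set Implicit Arguments.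
Unset Strict Implicit.
Unset Printing Implicit Defensive.

Local Open Scope group_scope.
Local Notation rot := seq.rot.

(** * Permutations given by lists of cycles *)

Section Cycles.

Variable T : finType.
Implicit Types (g h : {perm T}) (cs ds : seq (seq T)) (c : seq T) (m : nat).

(** For [n >= 9], all that is used of an element is its cycle type, with one exception. A type is
    even or odd by the parity of its number of parts, so odd and even degrees need different lists
    of types. Most of these have few parts, hence few partial sums, and one part 3 but no other
    multiple of 3, so that a power is a 3-cycle. Blocks take the place of Jordan's theorem on
    primitive groups because their size is bound by such sums, while primitivity would need an
    argument of its own. The exception is degree 9 with [k = 4]: PGammaL(2,8) on the projective line
    is a proper transitive subgroup of A_9 containing all even types without partial sum 4, namely
    9, 7+1+1, 6+2+1 and 3+3+3. So types cannot suffice there, and the splitting of the 9-cycles into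
    two classes of A_9 is used. The splitting of classes also matters for [4 <= n <= 8]: elements of
    one type need not be conjugate in A_n, so each type must be led into [H] or [K] by an even
    conjugator. *)

Definition has_cycles g cs : bool :=
  [&& uniq (flatten cs), all (fun c => map g c == rot 1 c) cs
    & [forall z, (z \notin flatten cs) ==> (g z == z)]].

(** Fixed points are parts equal to 1. The parts come in any order, so that a distinguished one can
    be put first. An empty cycle may give a part 0; where this matters, the parts are assumed
    positive. *)
Definition has_cycle_type g (lam : seq nat) : Prop :=
  exists cs, [/\ has_cycles g cs, flatten cs =i predT & map size cs = lam].

Lemma has_cyclesP g cs :
  reflect [/\ uniq (flatten cs), {in cs, forall c, map g c = rot 1 c}
            & forall z, z \notin flatten cs -> g z = z]
          (has_cycles g cs).
Proof.
apply: (iffP and3P) => [[u /allP cyc /forallP fx]|[u cyc fx]]; split=> //.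
- by move=> c /cyc/eqP.
- by move=> z /(implyP (fx z))/eqP.
- by apply/allP => c /cyc ->.
- by apply/forallP => z; apply/implyP => /fx ->.
Qed.

Lemma has_cyclesJ g (s : {perm T}) cs :
  has_cycles g cs -> has_cycles (g ^ s) (map (map s) cs).
Proof.
case/has_cyclesP=> u cyc fx; apply/has_cyclesP; split.
- by rewrite -map_flatten map_inj_uniq //; apply: perm_inj.
- move=> _ /mapP[c /cyc Hc ->]; rewrite -map_rot -Hc -!map_comp.
  by apply: eq_map => z /=; rewrite permJ.
- move=> z; rewrite -map_flatten; rewrite -[z](permKV s) mem_map; last exact: perm_inj.
  by rewrite permJ => /fx ->.
Qed.

Lemma has_cycle_typeJ g (s : {perm T}) lam : has_cycle_type g lam -> has_cycle_type (g ^ s) lam.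
Proof.
case=> cs [cyc full sz]; exists (map (map s) cs); split.
- exact: has_cyclesJ.
- move=> z; rewrite -map_flatten -[z](permKV s) mem_map ?full //.
  exact: perm_inj.
- by rewrite -map_comp -sz; apply: eq_map => c /=; rewrite size_map.
Qed.

Lemma uniq_flatten_mem (A : eqType) (ss : seq (seq A)) s :
  uniq (flatten ss) -> s \in ss -> uniq s.
Proof.
elim: ss => //= t ss IH; rewrite cat_uniq inE => /and3P[ut _ uf].
by case/predU1P => [->//|/(IH uf)].
Qed.

Lemma uniq_flatten_inj (A : eqType) (ss : seq (seq A)) s t (z : A) :
  uniq (flatten ss) -> s \in ss -> t \in ss -> z \in s -> z \in t -> s = t.
Proof.
move=> u sss tss zs zt; elim: ss u sss tss => //= e ss IH.
rewrite cat_uniq !inE => /and3P[_ /hasPn dis uf].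
have out r : r \in ss -> z \in r -> z \notin e.
  by move=> rss zr; apply: dis; apply/flattenP; exists r.
case/predU1P=> [sE|sss] /predU1P[tE|tss]; last exact: IH.
- by rewrite sE tE.
- by case/negP: (out t tss zt); rewrite -sE.
- by case/negP: (out s sss zs); rewrite -tE.
Qed.

Lemma perm_in_flatten g c z : map g c = rot 1 c -> z \in c -> g z \in c.
Proof. by move=> E zc; rewrite -(mem_rot 1) -E map_f. Qed.

Lemma nth_rot1 (z0 : T) (c : seq T) i :
  i < size c -> nth z0 (rot 1 c) i = nth z0 c (i.+1 %% size c).
Proof.
case: c => // a c; rewrite rot1_cons /= ltnS => ile.
rewrite nth_rcons; case: ltngtP ile => // [ilt|->] _.
  by rewrite modn_small.
by rewrite modnn.
Qed.

Lemma permX_cycle g c (z0 : T) m i :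
  map g c = rot 1 c -> i < size c ->
  (g ^+ m) (nth z0 c i) = nth z0 c ((i + m) %% size c).
Proof.
move=> E ilt; elim: m => [|m IH].
  by rewrite expg0 perm1 addn0 modn_small.
have sz : 0 < size c by apply: leq_ltn_trans ilt.
rewrite expgSr permM IH -(nth_map z0 z0 g) ?ltn_mod // E nth_rot1 ?ltn_mod //.
by congr (nth _ _ _); rewrite -addn1 modnDml addn1 addnS.
Qed.

Lemma permX_cycle_index g c z m : map g c = rot 1 c -> z \in c ->
  (g ^+ m) z = nth z c ((index z c + m) %% size c).
Proof.
by move=> E zc; rewrite -{1}(nth_index z zc) (permX_cycle z m E) ?index_mem.
Qed.

Lemma permX_cycle_mem g c z m : map g c = rot 1 c -> z \in c -> (g ^+ m) z \in c.
Proof.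
move=> E zc; rewrite (permX_cycle_index m E zc) mem_nth ?ltn_mod //.
by case: c zc {E}.
Qed.

Lemma permX_cycle_fix g c z m : map g c = rot 1 c -> uniq c -> z \in c ->
  ((g ^+ m) z == z) = (size c %| m).
Proof.
move=> E uc zc; have ilt : index z c < size c by rewrite index_mem.
rewrite (permX_cycle_index m E zc) -[X in _ == X](nth_index z zc).
rewrite nth_uniq ?ltn_mod //; last by case: c zc {E uc ilt}.
by rewrite -[X in _ == X](modn_small ilt) -[X in _ == X %[mod _]]addn0 eqn_modDl mod0n.
Qed.

Lemma cycle_trans g c y z : map g c = rot 1 c -> y \in c -> z \in c ->
  exists m, (g ^+ m) y = z.
Proof.
move=> E yc zc; have [iy iz] : index y c < size c /\ index z c < size c.
  by rewrite !index_mem.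
exists (index z c + (size c - index y c)); rewrite (permX_cycle_index _ E yc).
rewrite addnCA subnKC; last exact: ltnW.
by rewrite modnDr modn_small // nth_index.
Qed.

Definition supp g : {set T} := [set z | g z != z].

Lemma card_flatten (ss : seq (seq T)) :
  uniq (flatten ss) -> #|[set z in flatten ss]| = sumn (map size ss).
Proof. by move=> u; rewrite cardsE (card_uniqP u) size_flatten. Qed.

Lemma flatten_filter_has (ss : seq (seq T)) (P : pred (seq T)) z :
  (z \in flatten (filter P ss)) = has (fun c => P c && (z \in c)) ss.
Proof.
apply/flattenP/hasP => [[c]|[c cs /andP[Pc zc]]].
  by rewrite mem_filter => /andP[Pc cs] zc; exists c => //; apply/andP.
by exists c; rewrite // mem_filter Pc.
Qed.

Lemma uniq_flatten_filter (ss : seq (seq T)) (P : pred (seq T)) :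
  uniq (flatten ss) -> uniq (flatten (filter P ss)).
Proof.
elim: ss => //= c ss IH; rewrite cat_uniq => /and3P[uc dis /IH uf].
case: ifP => //= _; rewrite cat_uniq uc uf andbT /=.
apply: contra dis => /hasP[z]; rewrite flatten_filter_has => /hasP[d ds /andP[_ zd]] zc.
by apply/hasP; exists z => //; apply/flattenP; exists d.
Qed.

(** A cycle of length [l] is fixed pointwise by [g ^+ m] if [l] divides [m]; otherwise each of its
    points is moved. *)
Lemma card_supp_expg g lam m : has_cycle_type g lam ->
  #|supp (g ^+ m)| = sumn [seq l <- lam | ~~ (l %| m)].
Proof.
case=> cs [/has_cyclesP[u cyc fx] full <-].
rewrite filter_map -card_flatten; last exact: uniq_flatten_filter.
apply: eq_card => z; rewrite [in LHS]inE [in RHS]inE flatten_filter_has.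
have /flattenP[c ccs zc] : z \in flatten cs by rewrite full.
rewrite (permX_cycle_fix m (cyc c ccs) (uniq_flatten_mem u ccs) zc).
apply/idP/hasP => [nd|[d dcs /andP[nd zd]]]; first by exists c => //; rewrite /= nd.
by rewrite -(permX_cycle_fix m (cyc c ccs) (uniq_flatten_mem u ccs) zc)
           (permX_cycle_fix m (cyc d dcs) (uniq_flatten_mem u dcs) zd).
Qed.

Lemma card_supp0 g : #|supp g| = 0 -> g = 1.
Proof.
move/eqP; rewrite cards_eq0 => /eqP E; apply/permP => z; rewrite perm1.
by apply/eqP/negPn; move/setP/(_ z): E; rewrite !inE => ->.
Qed.

Lemma sumn_cycle_type g lam : has_cycle_type g lam -> sumn lam = #|T|.
Proof.
case=> cs [/has_cyclesP[u _ _] full <-]; rewrite -card_flatten // cardsE.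
by apply: eq_card.
Qed.

(* The mask selects the cycles meeting [U], so a cycle through a point of [U] is selected. *)
Lemma stable_partial_sum g cs (U : {set T}) :
    has_cycles g cs -> flatten cs =i predT -> {in U, forall z, g z \in U} ->
  #|U| = sumn (mask (map (has (mem U)) cs) (map size cs)).
Proof.
case/has_cyclesP=> u cyc _ full st.
have -> : mask (map (has (mem U)) cs) (map size cs)
          = map size (filter (has (mem U)) cs).
  by rewrite filter_mask map_mask.
rewrite -card_flatten; last exact: uniq_flatten_filter.
apply: eq_card => z; rewrite inE flatten_filter_has.
apply/idP/hasP => [zU|[c ccs /andP[/hasP[y yc /= yU] zc]]].
  have /flattenP[c ccs zc] : z \in flatten cs by rewrite full.
  by exists c => //; rewrite zc andbT; apply/hasP; exists z.
have [m <-] := cycle_trans (cyc c ccs) yc zc.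
elim: m => [|m IH]; first by rewrite expg0 perm1.
by rewrite expgSr permM st.
Qed.

Lemma has_cycles_eq g h cs : has_cycles g cs -> has_cycles h cs -> g = h.
Proof.
case/has_cyclesP=> u cg fg /has_cyclesP[_ ch fh]; apply/permP => z.
have [/flattenP[c ccs zc]|nz] := boolP (z \in flatten cs); last by rewrite fg ?fh.
by move: (permX_cycle_index 1 (cg c ccs) zc) (permX_cycle_index 1 (ch c ccs) zc);
  rewrite !expg1 => -> ->.
Qed.

Lemma map_eq_nth (s t : seq T) (z0 : T) : uniq s -> size s = size t ->
  map (fun z => nth z0 t (index z s)) s = t.
Proof.
move=> us E; apply: (@eq_from_nth _ z0); rewrite size_map // => i ilt.
by rewrite (nth_map z0) // index_uniq.
Qed.

Lemma perm_of_enumerations (s t : seq T) :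
    uniq s -> uniq t -> s =i predT -> t =i predT ->
  exists w : {perm T}, map w s = t.
Proof.
move=> us ut fs ft.
have E : size s = size t by rewrite -(card_uniqP us) -(card_uniqP ut) !(eq_card fs) (eq_card ft).
case: s us fs E => [|z0 s] us fs E.
  by exists 1; rewrite (size0nil (esym E)).
have inj : injective (fun z => nth z0 t (index z (z0 :: s))).
  move=> y z /eqP; rewrite nth_uniq -?E ?index_mem ?fs // => /eqP.
  by move=> /(congr1 (nth z0 (z0 :: s))); rewrite !nth_index ?fs.
exists (perm inj); rewrite -[RHS](map_eq_nth z0 us E).
by apply: eq_map => z; rewrite permE.
Qed.

Definition cycle_next cs (z : T) : T :=
  foldr (fun c r => if z \in c then next c z else r) z cs.

Lemma cycle_next_mem cs c z :
  uniq (flatten cs) -> c \in cs -> z \in c -> cycle_next cs z = next c z.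
Proof.
elim: cs => //= d cs IH; rewrite cat_uniq inE => /and3P[_ dis uf].
case/predU1P=> [<- -> //|ccs] zc; case: ifP => zd; last exact: IH.
by case/negP: dis; apply/hasP; exists z => //; apply/flattenP; exists c.
Qed.

Lemma map_next_rot c : uniq c -> map (next c) c = rot 1 c.
Proof.
case: c => // a c uc; apply: (@eq_from_nth _ a); rewrite size_map ?size_rot // => i ilt.
rewrite (nth_map a) // next_nth mem_nth // index_uniq // nth_rot1 //.
move: ilt; rewrite /= ltnS leq_eqVlt => /orP[/eqP->|ilt].
  by rewrite modnn nth_default.
by rewrite modn_small //=; apply: set_nth_default.
Qed.

(** The enumeration of [T] is cut into segments of the prescribed lengths, and each segment is
    rotated. *)
Lemma exists_cycle_type (lam : seq nat) : sumn lam = #|T| ->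
  exists g, has_cycle_type g lam.
Proof.
move=> E; set cs := reshape lam (enum T).
have fl : flatten cs = enum T by rewrite reshapeKr // -cardE E.
have sz : map size cs = lam by apply: (reshapeKl (s := enum T)); rewrite -cardE E.
have u : uniq (flatten cs) by rewrite fl enum_uniq.
have full : flatten cs =i predT by move=> z; rewrite fl mem_enum.
have cyc c : c \in cs -> map (cycle_next cs) c = rot 1 c.
  move=> ccs; rewrite -map_next_rot ?(uniq_flatten_mem u ccs) //.
  by apply/eq_in_map => z zc; apply: cycle_next_mem.
(* The map sends the duplicate-free enumeration of all points to a rearrangement of itself, which
   gives injectivity. *)
have im : perm_eq (map (cycle_next cs) (flatten cs)) (flatten cs).
  rewrite map_flatten; have -> : map (map (cycle_next cs)) cs = map (rot 1) cs.
    by apply/eq_in_map => c /cyc.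
  elim: (cs) => //= c ds IH; apply: perm_cat => //.
  by rewrite perm_rot.
have inj : injective (cycle_next cs).
  by apply/injectiveP; rewrite /injectiveb /dinjectiveb -fl (perm_uniq im).
exists (perm inj), cs; split => //; apply/has_cyclesP; split=> //.
  by move=> c /cyc <-; apply: eq_map => z; rewrite permE.
by move=> z; rewrite full.
Qed.

(** The sign is defined through the number of orbits. Each nonempty cycle is one orbit, whereas a
    part 0 would be counted without being one. *)
Lemma odd_cycle_type g lam : all (leq 1) lam -> has_cycle_type g lam ->
  odd_perm g = odd #|T| (+) odd (size lam).
Proof.
move=> pos [cs [/has_cyclesP[u cyc fx] full E]].
rewrite /odd_perm -E size_map; congr (_ (+) odd _).
have orb c z : c \in cs -> z \in c -> porbit g z = [set y in c].
  move=> ccs zc; apply/setP => y; rewrite inE.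
  apply/porbitP/idP => [[m ->]|yc]; first exact: permX_cycle_mem (cyc c ccs) zc.
  by have [m <-] := cycle_trans (cyc c ccs) zc yc; exists m.
have ne c : c \in cs -> exists z, z \in c.
  move=> ccs; have /(allP pos) : size c \in lam by rewrite -E map_f.
  by case: c {ccs} => // a c _; exists a; rewrite mem_head.
rewrite -(size_map (fun c => [set y in c]) cs); set os := map _ _.
have uo : uniq os.
  rewrite map_inj_in_uniq.
    elim: (cs) (u) ne => //= c ds IH; rewrite cat_uniq => /and3P[_ dis uf] ne.
    rewrite IH // ?andbT; last by move=> d dds; apply: ne; rewrite inE dds orbT.
    apply: contra dis => cds; have [z zc] := ne c (mem_head _ _).
    by apply/hasP; exists z => //; apply/flattenP; exists c.
  move=> c d ccs dcs /setP Ecd; have [z zc] := ne c ccs.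
  have zd : z \in d by move: (Ecd z); rewrite !inE zc.
  exact: (uniq_flatten_inj u ccs dcs zc zd).
rewrite -(card_uniqP uo); apply: eq_card => X.
apply/imsetP/mapP => [[z _ ->]|[c ccs ->]].
  have /flattenP[c ccs zc] : z \in flatten cs by rewrite full.
  by exists c => //; apply: orb.
by have [z zc] := ne c ccs; exists z => //; rewrite (orb c).
Qed.

End Cycles.

(** * Transitive groups containing a 3-cycle *)

Section ThreeCycles.

Variable T : finType.
Implicit Types (g h : {perm T}) (a b c d e z : T).

(** Products act from left to right, so for distinct points this is [a -> b -> c -> a]; for [b = c]
    it is the identity. *)
Definition cycle3 a b c : {perm T} := tperm a b * tperm a c.

Lemma cycle3V a b c : uniq [:: a; b; c] -> (cycle3 a b c)^-1 = cycle3 b a c.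
Proof.
rewrite /= !inE negb_or => /andP[/andP[ab ac] /andP[bc _]].
rewrite /cycle3 invMg !tpermV conjgC tpermJ tpermL tpermD // 1?eq_sym //.
by rewrite (tpermC b a).
Qed.

Lemma cycle3_rot a b c : uniq [:: a; b; c] -> cycle3 a b c = cycle3 b c a.
Proof.
rewrite /= !inE negb_or => /andP[/andP[ab ac] /andP[bc _]].
rewrite /cycle3 [RHS]conjgC tpermJ tpermL tpermD // 1?eq_sym //.
by rewrite (tpermC b a).
Qed.

Lemma cycle3J a b c g : cycle3 a b c ^ g = cycle3 (g a) (g b) (g c).
Proof. by rewrite conjMg !tpermJ. Qed.

Lemma cycle3E a b c : uniq [:: a; b; c] ->
  [/\ cycle3 a b c a = b, cycle3 a b c b = c, cycle3 a b c c = a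
    & forall z, z \notin [:: a; b; c] -> cycle3 a b c z = z].
Proof.
rewrite /= !inE negb_or => /andP[/andP[ab ac] /andP[bc _]]; rewrite /cycle3.
split; rewrite ?permM ?tpermL ?tpermR //.
- by rewrite tpermD // eq_sym.
- by rewrite tpermL.
- by rewrite (tpermD ac bc) tpermR.
- move=> z; rewrite !inE !negb_or permM => /and3P[za zb zc].
  by rewrite !tpermD // eq_sym.
Qed.

Variable H : {group {perm T}}.

(* Equivalence classes of this relation are blocks on which [H] induces all even permutations. *)
Definition linked a b : bool :=
  (a == b) || [exists c, uniq [:: a; b; c] && (cycle3 a b c \in H)].

Lemma linkedP a b :
  reflect (a = b \/ exists2 c, uniq [:: a; b; c] & cycle3 a b c \in H) (linked a b).
Proof.
apply: (iffP orP) => [[/eqP|/existsP[c /andP[]]]|[->|[c u ch]]]; [by left|by right; exists c| |].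
  by left.
by right; apply/existsP; exists c; apply/andP.
Qed.

Lemma linked_refl : reflexive linked.
Proof. by move=> a; rewrite /linked eqxx. Qed.

Lemma linked_sym : symmetric linked.
Proof.
suff imp a b : linked a b -> linked b a by move=> a b; apply/idP/idP; apply: imp.
case/linkedP=> [->|[c u ch]]; first exact: linked_refl.
apply/linkedP; right; exists c; last by rewrite -cycle3V ?groupV.
by move: u; rewrite /= !inE !negb_or (eq_sym b a) => /andP[/andP[-> ->] /andP[-> _]].
Qed.

Lemma linkedJ g a b : g \in H -> linked a b -> linked (g a) (g b).
Proof.
move=> gh /linkedP[->|[c u ch]]; first exact: linked_refl.
apply/linkedP; right; exists (g c); last by rewrite -cycle3J memJ_norm // (subsetP (normG H)).
by rewrite -(map_inj_uniq (@perm_inj _ g)) in u.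
Qed.

(** Let [cycle3 z a e] link [z] to [a]. If [e = b] it is a rotation of the goal. Otherwise
    conjugating [cycle3 a b c] by its inverse turns [a] into [z] and fixes [b], which gives a
    3-cycle through [z], [b] and one of [a], [c]. *)
Lemma cycle3_extend a b c z : uniq [:: a; b; c] -> cycle3 a b c \in H ->
  z \notin [:: a; b] -> linked z a -> cycle3 a b z \in H.
Proof.
move=> u ch; rewrite !inE negb_or => /andP[za zb] /linkedP[zE|[e ue eh]].
  by rewrite zE eqxx in za.
have u' := u; move: u'; rewrite /= !inE !negb_or => /andP[/andP[ab ac] /andP[bc _]].
have ue' := ue; move: ue'; rewrite /= !inE !negb_or => /andP[/andP[_ ze] /andP[ae _]].
have HJ g h : g \in H -> h \in H -> g ^ h \in H by move=> *; rewrite groupJ.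
have [->|zc] := eqVneq z c; first by [].
(* [cycle3 z b a] is inverted, while [cycle3 z b c] is conjugated by the inverse of
   [cycle3 a b c]. *)
have Hz w : cycle3 z b w \in H -> w \in [:: a; c] -> cycle3 a b z \in H.
  move=> wh; rewrite !inE => /orP[]/eqP wE; rewrite wE in wh.
    have uz : uniq [:: z; b; a] by rewrite /= !inE negb_or zb za (eq_sym b) ab.
    rewrite -groupV cycle3V -?(cycle3_rot uz) //.
    by rewrite /= !inE !negb_or ab !(eq_sym _ z) za zb.
  have [E1 E2 E3 E4] := cycle3E u.
  move: (HJ _ _ wh (groupVr ch)); rewrite cycle3J.
  have -> : (cycle3 a b c)^-1 z = z.
    by apply: (canLR (permK _)); rewrite E4 // !inE !negb_or za zb zc.
  have -> : (cycle3 a b c)^-1 b = a by apply: (canLR (permK _)).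
  have -> : (cycle3 a b c)^-1 c = b by apply: (canLR (permK _)).
  by rewrite cycle3_rot //= !inE !negb_or za zb ab.
have [eb|eb] := eqVneq e b.
  rewrite eb in eh ue.
  by rewrite -(cycle3_rot ue).
have [E1 E2 E3 E4] := cycle3E ue.
have Va : (cycle3 z a e)^-1 a = z by apply: (canLR (permK _)).
have Vb : (cycle3 z a e)^-1 b = b.
  by apply: (canLR (permK _)); rewrite E4 // !inE !negb_or (eq_sym b) zb (eq_sym b) ab (eq_sym b).
move: (HJ _ _ ch (groupVr eh)); rewrite cycle3J Va Vb.
have [ec|ec] := eqVneq e c.
  have -> : (cycle3 z a e)^-1 c = a by apply: (canLR (permK _)); rewrite -ec.
  by move/Hz; apply; rewrite !inE eqxx.
have -> : (cycle3 z a e)^-1 c = c.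
  by apply: (canLR (permK _)); rewrite E4 // !inE !negb_or (eq_sym c) zc (eq_sym c) ac (eq_sym c).
by move/Hz; apply; rewrite !inE eqxx orbT.
Qed.

Lemma linked_trans : transitive linked.
Proof.
move=> b a d /linkedP[->//|[c u ch]] lbd.
have [->|da] := eqVneq d a; first exact: linked_refl.
have [db|db] := eqVneq d b; first by rewrite db; apply/linkedP; right; exists c.
have u' : uniq [:: b; a; c].
  by move: u; rewrite /= !inE !negb_or (eq_sym b a) => /andP[/andP[-> ->] /andP[-> _]].
have bac : cycle3 b a c \in H by rewrite -cycle3V ?groupV.
have bad : cycle3 b a d \in H.
  by apply: (cycle3_extend u' bac); rewrite ?inE ?negb_or ?db // linked_sym.
have ub : uniq [:: b; a; d].
  move: u'; rewrite /= !inE !negb_or => /andP[/andP[-> _] _].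
  by rewrite (eq_sym b) db (eq_sym a) da.
apply/linkedP; right; exists b; last by rewrite -(cycle3_rot ub).
by rewrite -(rot_uniq 2).
Qed.

Lemma cycle3_linked a b c :
  uniq [:: a; b; c] -> linked a b -> linked a c -> cycle3 a b c \in H.
Proof.
move=> u /linkedP[E|[d ud dh]] lac; first by move: u; rewrite E /= !inE eqxx.
apply: (cycle3_extend ud dh); last by rewrite linked_sym.
move: u; rewrite /= !inE !negb_or => /andP[/andP[_ ac] /andP[bc _]].
by rewrite (eq_sym c) ac eq_sym bc.
Qed.

(** Even permutations are products of pairs of transpositions, and each pair is a product of at most
    two 3-cycles: if the pairs [a], [b] and [c], [d] have [a != c], the factor [tperm a c] is
    inserted twice. *)
Lemma linked_total_Alt : (forall a b, linked a b) -> 'Alt_T \subset H.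
Proof.
move=> tot; have C a b c : a != b -> a != c -> cycle3 a b c \in H.
  move=> ab ac; have [<-|bc] := eqVneq b c; first by rewrite /cycle3 tperm2.
  by apply: cycle3_linked; rewrite //= !inE negb_or ab ac bc.
have D a b c d : a != b -> c != d -> tperm a b * tperm c d \in H.
  move=> ab cd; have [ac|ac] := eqVneq a c; first by rewrite -ac in cd *; exact: C.
  have -> : tperm a b * tperm c d = cycle3 a b c * cycle3 c a d.
    by rewrite /cycle3 (tpermC c a) mulgA -(mulgA (tperm a b)) tperm2 mulg1.
  by rewrite groupM ?C // eq_sym.
apply/subsetP => s; rewrite Alt_even; have [ts -> dts] := prod_tpermP s.
rewrite odd_perm_prod //; have [n] := ubnP (size ts).
elim: n ts dts => // n IH [|t [|t' ts]] //=; first by rewrite big_nil.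
move=> /and3P[dt dt' dts] lt; rewrite negbK => ev.
rewrite !big_cons mulgA groupM ?D ?IH //.
by rewrite ltnW // -ltnS.
Qed.

Definition linked_class a : {set T} := [set z | linked a z].

Definition ktransitive k : Prop := forall s t : seq T,
  uniq s -> uniq t -> size s = k -> size t = k -> exists2 g, g \in H & map g s = t.

Definition transitive_group : Prop := forall a b, exists2 g, g \in H & g a = b.

Lemma linked_classJ g a : g \in H -> linked_class (g a) = g @: linked_class a.
Proof.
move=> gh; apply/setP => z; rewrite -[z](permKV g) mem_imset ?inE; last exact: perm_inj.
apply/idP/idP; last exact: linkedJ.
by move/(linkedJ (groupVr gh)); rewrite !permK.
Qed.

Lemma card_linked_closed a (U : {set T}) : transitive_group ->
    (forall y z, y \in U -> linked y z -> z \in U) ->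
  #|U| = (#|[set linked_class z | z in U]| * #|linked_class a|)%N.
Proof.
move=> tr cl.
have eqr : {in U & &, equivalence_rel (linked)}.
  move=> x y z _ _ _; split; first exact: linked_refl.
  by move=> xy; apply/idP/idP; apply: linked_trans => //; rewrite linked_sym.
have E : equivalence_partition (linked) U = [set linked_class z | z in U].
  apply: eq_in_imset => z zU; apply/setP => y; rewrite !inE.
  by case: (boolP (linked z y)) => [/(cl _ _ zU)->//|]; rewrite andbF.
rewrite -E; apply: card_uniform_partition; last exact: equivalence_partitionP.
move=> X; rewrite E => /imsetP[z _ ->]; have [g gh <-] := tr a z.
by rewrite linked_classJ // card_imset //; apply: perm_inj.
Qed.

Lemma linked_class_card_dvd a : transitive_group -> #|linked_class a| %| #|T|.
Proof.
move=> tr; rewrite -cardsT (@card_linked_closed a setT tr) ?dvdn_mull //.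
Qed.

Lemma supp3P g : #|supp g| = 3 -> g ^+ 3 = 1 ->
  exists a b c, [/\ uniq [:: a; b; c], g = cycle3 a b c & supp g =i [:: a; b; c]].
Proof.
move=> s3 g3; have /card_gt0P[a] : 0 < #|supp g| by rewrite s3.
rewrite inE => ga.
have gggE : g (g (g a)) = a by move: (permX g a 3); rewrite g3 perm1 /= => <-.
have u : uniq [:: a; g a; g (g a)].
  have ag : a != g a by rewrite eq_sym.
  rewrite /= !inE negb_or (inj_eq perm_inj) ag /= andbT.
  by apply: contraNneq ga => E; rewrite {1}E gggE.
have E : supp g =i [:: a; g a; g (g a)].
  apply: fsym; apply/subset_cardP; first by rewrite s3 (card_uniqP u).
  apply/subsetP => z; rewrite !inE => /or3P[]/eqP-> //; rewrite ?(inj_eq perm_inj) //.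
exists a, (g a), (g (g a)); split => //; apply/permP => z.
have [E1 E2 E3 E4] := cycle3E u.
have [|nz] := boolP (z \in [:: a; g a; g (g a)]); last first.
  by rewrite E4 //; move: nz; rewrite -E inE negbK => /eqP.
by rewrite !inE => /or3P[]/eqP->; rewrite ?E1 ?E2 ?E3.
Qed.


Lemma linked_class_sums a g lam i :
    transitive_group -> g \in H -> has_cycle_type g lam ->
    i < size lam -> 0 < nth 0 lam i ->
  exists m r, [/\ size m = size lam, nth false m i, 0 < r <= nth 0 lam i
                & sumn (mask m lam) = r * #|linked_class a|]%N.
Proof.
move=> tr gh [cs [cyc full E]] ilt pos; have [u cg fx] := has_cyclesP _ _ cyc.
have ics : i < size cs by rewrite -(size_map size) E.
pose c := nth [::] cs i; have ccs : c \in cs by rewrite mem_nth.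
have szc : size c = nth 0 lam i by rewrite -E (nth_map [::]).
have [z zc] : exists z, z \in c.
  by rewrite -szc in pos; case: (c) pos => // z d _; exists z; rewrite mem_head.
(* [U] is the union of the classes that meet the cycle [c]. Being stable under [g], it is a union of
   cycles, and it contains at most as many classes as [c] has points. *)
pose U := \bigcup_(y in c) linked_class y.
have UP y : reflect (exists2 x, x \in c & linked x y) (y \in U).
  by apply: (iffP bigcupP) => -[x xc]; rewrite ?inE => ?; exists x; rewrite ?inE.
have cl x y : x \in U -> linked x y -> y \in U.
  by case/UP=> w wc wx xy; apply/UP; exists w => //; apply: linked_trans xy.
have st : {in U, forall y, g y \in U}.
  move=> y /UP[x xc xy]; apply/UP; exists (g x); last exact: linkedJ.
  exact: perm_in_flatten (cg c ccs) xc.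
have zU : z \in U by apply/UP; exists z => //; apply: linked_refl.
exists (map (has (mem U)) cs), #|[set linked_class y | y in U]|; split.
- by rewrite size_map -E size_map.
- by rewrite (nth_map [::]) //; apply/hasP; exists z.
- rewrite -szc; apply/andP; split.
    by apply/card_gt0P; exists (linked_class z); apply: imset_f.
  apply: leq_trans (card_size c).
  apply: leq_trans (leq_imset_card linked_class (mem c)).
  apply/subset_leq_card/subsetP => X /imsetP[y /UP[x xc xy] ->].
  apply/imsetP; exists x => //; apply/setP => w; rewrite !inE.
  by apply/idP/idP; apply: linked_trans; rewrite // linked_sym.
- by rewrite -E -(stable_partial_sum cyc full st); apply: card_linked_closed.
Qed.

(** The exponent is the product of the other lengths: it kills their cycles, and being prime to 3 it
    leaves a 3-cycle. *)
Lemma isolated3_power g lam : all (fun l => ~~ (3 %| l)) lam ->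
    has_cycle_type g (3 :: lam) ->
  exists m, [/\ ~~ (3 %| m), #|supp (g ^+ m)| = 3 & (g ^+ m) ^+ 3 = 1].
Proof.
move=> iso ct; exists (foldr muln 1%N lam).
have dv l : l \in lam -> l %| foldr muln 1%N lam.
  elim: lam {iso ct} => //= a s IH; rewrite inE => /predU1P[->|/IH]; first exact: dvdn_mulr.
  exact: dvdn_mull.
have n3 : ~~ (3 %| foldr muln 1%N lam).
  by elim: lam iso {ct dv} => //= a s IH /andP[na /IH]; rewrite Euclid_dvdM // (negPf na).
have fl k : foldr muln 1%N lam %| k -> [seq l <- lam | ~~ (l %| k)] = [::].
  move=> dk; apply/eqP; rewrite -(negbK (_ == _)) -has_filter -all_predC.
  by apply/allP => l /dv dl /=; rewrite negbK (dvdn_trans dl).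
split=> //; first by rewrite (card_supp_expg _ ct) /= n3 fl.
apply: card_supp0; rewrite -expgM (card_supp_expg _ ct) /= dvdn_mull //=.
by rewrite fl ?dvdn_mulr.
Qed.

(** The 3-cycle among the powers of [g] lies inside one class and [g] permutes its three points, so
    [g] stabilizes this class. Hence the size of a single class is a partial sum, which is sharper
    than [linked_class_sums], where a multiple of it occurs. *)
Lemma isolated3_sums g lam :
    transitive_group -> g \in H -> has_cycle_type g (3 :: lam) ->
    all (fun l => ~~ (3 %| l)) lam ->
  exists a, 3 <= #|linked_class a| /\
    exists2 m, size m = size lam & (3 + sumn (mask m lam))%N = #|linked_class a|.
Proof.
move=> tr gh ct iso; have [m [n3 s3 p3]] := isolated3_power iso ct.
have [a [b [c [u xE sx]]]] := supp3P s3 p3.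
case: ct => -[|c0 cs] [cyc full] //= [sz0 E].
have [uf cg _] := has_cyclesP _ _ cyc.
have xh : cycle3 a b c \in H by rewrite -xE groupX.
have [la lb] : linked a b /\ linked a c.
  split; apply/linkedP; right; first by exists c.
  have u' : uniq [:: b; a; c].
    by move: u; rewrite /= !inE !negb_or (eq_sym b a) => /andP[/andP[-> ->] /andP[-> _]].
  exists b; last by rewrite -(cycle3_rot u') -cycle3V ?groupV.
  by rewrite -(rot_uniq 2).
pose U := linked_class a.
have sU z : z \in supp (g ^+ m) -> z \in U.
  by rewrite sx !inE => /or3P[]/eqP-> //; apply: linked_refl.
have st : {in U, forall y, g y \in U}.
  (* [g] commutes with its power and so preserves the support of that power. *)
  have ga : g a \in supp (g ^+ m).
    have: a \in supp (g ^+ m) by rewrite sx mem_head.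
    rewrite !inE -permM (commuteX m (commute_refl g)) permM.
    by rewrite (inj_eq perm_inj).
  have lga : linked a (g a) by move/sU: ga; rewrite inE.
  by move=> y; rewrite !inE => ay; apply: linked_trans lga (linkedJ gh ay).
have c0U : has (mem U) c0.
  case: (c0) sz0 (cg c0 (mem_head _ _)) (uniq_flatten_mem uf (mem_head _ _)) => // z d sz cz uz.
  apply/hasP; exists z; rewrite ?mem_head //=; apply: sU.
  by rewrite inE (permX_cycle_fix m cz uz (mem_head _ _)) sz.
exists a; split.
  suff : #|[:: a; b; c]| <= #|linked_class a| by rewrite (card_uniqP u).
  by apply/subset_leq_card/subsetP => z; rewrite -sx => /sU.
exists (map (has (mem U)) cs); first by rewrite size_map -E size_map.
by rewrite -/U (stable_partial_sum cyc full st) /= c0U /= sz0 E.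
Qed.

End ThreeCycles.

(** * Cycle types occurring in a group, and multiple transitivity *)

Section Types.

Variable T : finType.
Implicit Types (g h : {perm T}) (H : {group {perm T}}) (a z : T).

Definition has_type H lam : Prop := exists2 g, g \in H & has_cycle_type g lam.

Fixpoint subset_sums (lam : seq nat) : seq nat :=
  if lam is l :: mu then subset_sums mu ++ map (addn l) (subset_sums mu) else [:: 0%N].

Lemma mem_subset_sums m lam : sumn (mask m lam) \in subset_sums lam.
Proof.
elim: lam m => [|l mu IH] [|[] m] //=; rewrite mem_cat.
- by rewrite (IH [::]).
- by rewrite (map_f (addn l) (IH m)) orbT.
- by rewrite IH.
Qed.

(** Gathers what a 3-cycle forces on the class size [b]. It is at most half of the degree because it
    divides the degree and a single class would put the alternating group into [H]. *)
Lemma has_type_block_size H lam : transitive_group H -> ~~ ('Alt_T \subset H) ->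
    all (fun l => ~~ (3 %| l)) lam -> has_type H (3 :: lam) ->
  exists b, [/\ 3 <= b, b %| #|T|, b.*2 <= #|T|,
    forall mu, all (fun l => ~~ (3 %| l)) mu -> has_type H (3 :: mu) ->
      b \in map (addn 3) (subset_sums mu)
  & forall l mu, 0 < l -> has_type H (l :: mu) ->
      exists2 r, 0 < r <= l & (r * b)%N \in map (addn l) (subset_sums mu)].
Proof.
move=> tr nA iso [g gh ct]; have [a [b3 _]] := isolated3_sums tr gh ct iso.
have cE z : #|linked_class H z| = #|linked_class H a|.
  have [h hh <-] := tr a z; rewrite linked_classJ // card_imset //; exact: perm_inj.
have dvd := linked_class_card_dvd a tr.
exists #|linked_class H a|; split=> //.
- have /dvdnP[k kE] := dvd; case: k kE => [|[|k]] kE.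
  + by move: (max_card (mem (linked_class H a))) b3; rewrite kE mul0n leqn0 => /eqP->.
  + case/negP: nA; apply: linked_total_Alt => y z.
    have: linked_class H y = setT.
      by apply/eqP; rewrite eqEcard subsetT cardsT kE mul1n (cE y) leqnn.
    by move/setP/(_ z); rewrite !inE.
  + by rewrite kE; lia.
- move=> mu imu [h hh hct]; have [z [_ [m _ E]]] := isolated3_sums tr hh hct imu.
  by rewrite -(cE z) -E map_f // mem_subset_sums.
- move=> l mu l0 [h hh hct].
  have [m [r [szm mi r0 E]]] := linked_class_sums a (i := 0) tr hh hct isT l0.
  exists r => //; rewrite -E; case: m szm mi {E} => //= c m _ ->.
  by rewrite /= (map_f (addn l)) // mem_subset_sums.
Qed.

Lemma card_stable_subset_sums H lam (U : {set T}) :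
    (forall g, g \in H -> {in U, forall z, g z \in U}) -> has_type H lam ->
  #|U| \in subset_sums lam.
Proof.
move=> st [g gh [cs [cyc full <-]]].
by rewrite (stable_partial_sum cyc full (st g gh)) mem_subset_sums.
Qed.

Lemma cycle_type_fixed_points g k l : has_cycle_type g (rcons (nseq k 1%N) l) ->
  exists s, [/\ uniq s, size s = k, {in s, forall y, g y = y}
    & forall y z, y \notin s -> z \notin s -> exists m, (g ^+ m) y = z].
Proof.
case=> cs [cyc full sz]; have [u cg fx] := has_cyclesP _ _ cyc.
case/lastP: cs cyc full sz u cg {fx} => [|cs c] cyc full; first by case: k.
rewrite map_rcons => /eqP; rewrite eqseq_rcons => /andP[/eqP sz _] u cg.
rewrite flatten_rcons in u full; exists (flatten cs); split.
- by move: u; rewrite cat_uniq => /andP[].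
- by rewrite size_flatten /shape sz sumn_nseq mul1n.
- move=> y /flattenP[d dcs yd].
  have := cg d; rewrite mem_rcons inE dcs orbT => /(_ isT).
  have: size d == 1%N.
    by have: size d \in nseq k 1%N; [rewrite -sz map_f | rewrite mem_nseq => /andP[]].
  by case: d yd {dcs} => [|q []] //=; rewrite inE => /eqP-> _ [].
- have inc w : w \notin flatten cs -> w \in c.
    by move=> nw; move: (full w); rewrite mem_cat (negPf nw).
  by move=> y z /inc yc /inc zc; apply: (cycle_trans (cg c _)); rewrite // mem_rcons mem_head.
Qed.

(** It suffices that the pointwise stabilizer of one list [s] is transitive outside [s], since
    [k]-transitivity moves [s] to any other list. *)
Lemma ktransitive_extend H k (s : seq T) x0 :
    ktransitive H k -> uniq s -> size s = k -> x0 \notin s ->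
    (forall z, z \notin s ->
       exists g, [/\ g \in H, {in s, forall y, g y = y} & g x0 = z]) ->
  ktransitive H k.+1.
Proof.
move=> tr us szs x0s st.
suff base a t : uniq (a :: t) -> size t = k ->
    exists2 g, g \in H & map g (x0 :: s) = a :: t.
  move=> [|a1 t1] [|a2 t2] // u1 u2 [sz1] [sz2].
  have [g1 h1 e1] := base _ _ u1 sz1; have [g2 h2 e2] := base _ _ u2 sz2.
  exists (g1^-1 * g2); first by rewrite groupM ?groupV.
  rewrite -e1 -e2 -map_comp; apply: eq_map => z /=.
  by rewrite permM permK.
move=> /andP[na ut] szt; have [h hh hE] := tr s t us ut szs szt.
have nz : h^-1 a \notin s.
  by apply: contra na => /(map_f h); rewrite permKV hE.
have [g [gh gs gx]] := st _ nz; exists (g * h); first exact: groupM.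
rewrite /= permM gx permKV -hE; congr (_ :: _); apply/eq_in_map => z /gs E.
by rewrite permM E.
Qed.

Lemma transitive_ktransitive H : transitive_group H -> ktransitive H 1.
Proof.
move=> tr s t _ _; case: s => [|a []] //; case: t => [|c []] // _ _; have [g gh E] := tr a c.
by exists g; rewrite /= ?E.
Qed.

Definition two_transitive H := forall a c a' c', a != c -> a' != c' ->
  exists g, [/\ g \in H, g a = a' & g c = c'].

Lemma ktransitive_two H : ktransitive H 2 -> two_transitive H.
Proof.
move=> tr a c a' c' ac ac'; have [||||g gh [E1 E2]] := tr [:: a; c] [:: a'; c'] => //.
- by rewrite /= inE ac.
- by rewrite /= inE ac'.
- by exists g.
Qed.

Lemma fixed_points_ktransitive H k l :
    k < #|T| -> ktransitive H k -> has_type H (rcons (nseq k 1%N) l) ->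
  ktransitive H k.+1.
Proof.
move=> kT tr [g gh ct]; have [s [us szs fs tc]] := cycle_type_fixed_points ct.
have [x0 x0s] : exists x0, x0 \notin s.
  apply/existsP; rewrite -negb_forall; apply: contraL kT => /forallP all_s.
  rewrite -leqNgt -szs -(card_uniqP us); apply/subset_leq_card/subsetP=> z _.
  exact: all_s.
apply: (ktransitive_extend tr us szs x0s) => z zs.
have [m <-] := tc _ _ x0s zs; exists (g ^+ m); split=> //; first exact: groupX.
by move=> y ys; apply: permX_fix; apply: fs.
Qed.

(** The powers of [g] join all points outside [p :: s], and [h], which also fixes [s], moves [p]
    among them. *)
Lemma ktransitive_extend_moved H k (h : {perm T}) (s : seq T) p (g : {perm T}) :
    ktransitive H k -> uniq (p :: s) -> size s = k -> g \in H -> h \in H ->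
    {in s, forall y, g y = y} -> {in s, forall y, h y = y} -> h p != p ->
    (forall y z, y \notin p :: s -> z \notin p :: s -> exists m, (g ^+ m) y = z) ->
  ktransitive H k.+1.
Proof.
move=> tr /andP[ps us] szs gh hh gs hs hp tc.
apply: (ktransitive_extend tr us szs ps) => z zs.
have [->|zp] := eqVneq z p.
  by exists 1; split=> // [y _|]; rewrite perm1.
have [||m mE] := tc (h p) z.
- rewrite inE negb_or hp /=; apply: contra ps => hps.
  by rewrite -(perm_inj (hs _ hps)).
- by rewrite inE negb_or zp.
exists (h * g ^+ m); split; last by rewrite permM.
  by rewrite groupM ?groupX.
by move=> y ys; rewrite permM hs // permX_fix // gs.
Qed.

(** A power [w ^+ j] of the full cycle takes the fixed point [p] of [g] to the other one, [q]. The
    conjugate of [g] by it fixes [q], and it moves [p] unless [w ^+ j] interchanges [p] and [q]. In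
    odd degree no power of a full cycle contains a 2-cycle. *)
Lemma odd_two_transitive H l : odd #|T| -> 4 <= #|T| ->
  has_type H [:: #|T|] -> has_type H [:: 1%N; 1%N; l] -> ktransitive H 2.
Proof.
move=> oT T4 [w wh [cs [cyc full sz]]] [g gh ct].
have [uc cg _] := has_cyclesP _ _ cyc.
case: cs full sz uc cg {cyc} => [|c [|]] //; rewrite /= cats0 => full [szc] uc /(_ c (mem_head _ _)) cw.
have inc y : y \in c by rewrite full.
have tr : transitive_group H.
  by move=> a z; have [m <-] := cycle_trans cw (inc a) (inc z); exists (w ^+ m); rewrite ?groupX.
have [s [us szs fs tc]] := @cycle_type_fixed_points g 2 l ct.
case: s us szs fs tc => [|p [|q []]] //= us _ fs tc.
have pq : p != q by move: us; rewrite inE => /andP[].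
have [j jE] := cycle_trans cw (inc p) (inc q).
(* As [g] is transitive outside [p], [q], a fixed point there would be the only point left, and the
   degree would be at most 3. *)
have mv y : y \notin [:: p; q] -> g y != y.
  move=> ny; apply: contraL T4 => /eqP gy; rewrite -ltnNge.
  have sub : #|T| <= size [:: p; q; y].
    apply: leq_trans (card_size _); apply/subset_leq_card/subsetP => z _.
    have [nz|] := boolP (z \in [:: p; q]); first by rewrite -cat1s mem_cat /= -(cat1s q) !inE in nz *; rewrite !orbA nz.
    by move=> /(tc _ _ ny)[m <-]; rewrite permX_fix // !inE eqxx !orbT.
  by [].
apply: (@ktransitive_extend_moved H 1 (g ^ (w ^+ j)) [:: q] p g) => //.
- exact: transitive_ktransitive.
- by rewrite groupJ ?groupX.
- by move=> y; rewrite inE => /eqP->; apply: fs; rewrite !inE eqxx orbT.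
- by move=> y; rewrite inE => /eqP->; rewrite -jE permJ fs // mem_head.
- rewrite -{1 2}[p](permKV (w ^+ j)) permJ (inj_eq perm_inj) mv // !inE negb_or.
  apply/andP; split; last first.
    apply/eqP => E; case/eqP: pq; rewrite -jE; apply/eqP.
    rewrite eq_sym (permX_cycle_fix j cw uc (inc p)) szc.
    have : #|T| %| 2 * j.
      rewrite -szc -(permX_cycle_fix _ cw uc (inc p)) mul2n -addnn expgD permM jE -E.
      by rewrite permKV.
    by rewrite Gauss_dvdr // coprimen2.
  by apply: contra pq => /eqP E; rewrite -jE -{2}E permKV.
Qed.

End Types.

(** * Computing with words in permutations of few points *)

(* Permutations of [0, N) are lists of images; the point [i] stands for the [i]-th
   element of a duplicate-free sequence [u] of at most [N] points. *)

Section ListPerms.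

Variable N : nat.

Definition lperm_of_cycles (cs : seq (seq nat)) : seq nat :=
  [seq foldr (fun c r => if i \in c then nth 0%N (rot 1 c) (index i c) else r) i cs
     | i <- iota 0 N].

Definition lmul (p q : seq nat) : seq nat := [seq nth 0%N q i | i <- p].

Definition lpow (p : seq nat) (m : nat) : seq nat := iter m (lmul^~ p) (iota 0 N).

Definition lword (gs : seq (seq nat)) (w : seq nat) : seq nat :=
  foldr (fun k r => lmul (nth [::] gs k) r) (iota 0 N) w.

Definition lmoved (p : seq nat) : nat := count (fun i => nth 0%N p i != i) (iota 0 N).

(* The exponent 280 = 8 * 5 * 7 leaves only the 3-part of a permutation of at most 9 points. *)
Definition lword280 (gs : seq (seq nat)) (w : seq nat) : seq nat :=
  lpow (lpow (lpow (lword gs w) 8) 5) 7.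

Definition lprime (p k : nat) (g : seq nat) : bool :=
  (lmoved g == k) && (lmoved (lpow g p) == 0%N).

End ListPerms.

Section Represent.

Variables (T : finType) (N : nat) (x0 : T) (u : seq T).
Hypotheses (uu : uniq u) (uN : size u <= N).
Implicit Types (g h : {perm T}) (p q : seq nat).

(** The width [N] is chosen in advance, although the size of [u] depends on how two supports
    overlap; one exhaustive check then serves all overlaps. Indices without a point are fixed. *)
Definition represents p g : Prop :=
  [/\ size p = N,
      forall i, i < size u -> nth 0%N p i < size u /\ g (nth x0 u i) = nth x0 u (nth 0%N p i),
      forall i, size u <= i -> i < N -> nth 0%N p i = i
    & forall z, z \notin u -> g z = z].

Lemma represents1 : represents (iota 0 N) 1.
Proof.
split=> [|i iu|i _ iN|z _]; rewrite ?size_iota ?perm1 ?nth_iota //.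
exact: leq_trans iu uN.
Qed.

Lemma representsM p q g h :
  represents p g -> represents q h -> represents (lmul p q) (g * h).
Proof.
move=> [sp ip op fp] [sq iq oq fq]; split.
- by rewrite size_map.
- move=> i iu; have [pu pE] := ip i iu; have [qu qE] := iq _ pu.
  rewrite (nth_map 0%N) ?sp ?(leq_trans iu) //; split=> //.
  by rewrite permM pE qE.
- by move=> i ui iN; rewrite (nth_map 0%N) ?sp // op // oq.
- by move=> z zu; rewrite permM fp // fq.
Qed.

Lemma representsX p g m : represents p g -> represents (lpow N p m) (g ^+ m).
Proof.
move=> pg; elim: m => [|m IH]; first exact: represents1.
by rewrite expgSr; apply: representsM.
Qed.

Lemma represents_word (gs : seq {perm T}) (ps : seq (seq nat)) w :
    size gs = size ps ->
    (forall k, k < size gs -> represents (nth [::] ps k) (nth 1 gs k)) ->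
    all (fun k => k < size gs) w ->
  represents (lword N ps w) (\prod_(k <- w) nth 1 gs k).
Proof.
move=> sz rep; elim: w => [_|k w IH] /=; first by rewrite big_nil; apply: represents1.
by case/andP=> kw /IH rw; rewrite big_cons; apply: representsM => //; apply: rep.
Qed.

Lemma represents_moved p g : represents p g -> #|supp g| = lmoved N p.
Proof.
case=> sp ip op fp.
have -> : lmoved N p = count (fun i => nth 0%N p i != i) (iota 0 (size u)).
  rewrite /lmoved -(subnKC uN) iotaD count_cat -[RHS]addn0; congr addn.
  rewrite -size_filter; apply/eqP; rewrite size_eq0 -(negbK (_ == _)) -has_filter.
  apply/hasPn => i; rewrite mem_iota subnKC // => /andP[ui iN].
  by rewrite negbK op.
rewrite -size_filter -(size_map (nth x0 u)).
set s := map _ _; have us : uniq s.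
  rewrite map_inj_in_uniq ?filter_uniq ?iota_uniq // => i j.
  rewrite !mem_filter !mem_iota => /andP[_ iu] /andP[_ ju] /eqP.
  by rewrite nth_uniq // => /eqP.
rewrite -(card_uniqP us); apply: eq_card => z; rewrite inE.
apply/idP/mapP => [gz|[i]].
  have zu : z \in u by apply: contraR gz => /fp ->.
  have iu : index z u < size u by rewrite index_mem.
  exists (index z u); last by rewrite nth_index.
  rewrite mem_filter mem_iota /= add0n iu andbT; apply: contra gz => /eqP E.
  by have [_] := ip _ iu; rewrite E nth_index // => ->.
rewrite mem_filter mem_iota /= add0n => /andP[ne iu] ->.
by have [pu ->] := ip i iu; rewrite nth_uniq.
Qed.

Lemma represents_cycles g cs : has_cycles g cs -> {subset flatten cs <= u} ->
  represents (lperm_of_cycles N (map (map (index^~ u)) cs)) g.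
Proof.
case/has_cyclesP=> uf cg fx sub.
have inu c z : c \in cs -> z \in c -> z \in u.
  by move=> ccs zc; apply: sub; apply/flattenP; exists c.
have iE z c : z \in u -> {subset c <= u} ->
    (index z u \in map (index^~ u) c) = (z \in c).
  move=> zu cu; apply/mapP/idP => [[y yc E]|zc]; last by exists z.
  suff -> : z = y by [].
  by rewrite -(nth_index x0 zu) E nth_index // cu.
have ixE z c : z \in c -> {subset c <= u} -> index (index z u) (map (index^~ u) c) = index z c.
  move=> zc cu; elim: c zc cu => //= y c IH; rewrite inE => zc cu.
  have yu : y \in u by apply: cu; rewrite mem_head.
  have zu : z \in u by apply: cu; rewrite inE.
  have -> : (index y u == index z u) = (y == z).
    by apply/eqP/eqP => [E|->] //; rewrite -(nth_index x0 yu) E nth_index.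
  move: zc; rewrite eq_sym; have [//|yz] := eqVneq y z; rewrite /= => zc.
  by rewrite IH // => w wc; apply: cu; rewrite inE wc orbT.
have next z : z \in u ->
   foldr (fun c r => if index z u \in c then nth 0%N (rot 1 c) (index (index z u) c) else r)
      (index z u) (map (map (index^~ u)) cs) = index (g z) u.
  move=> zu; have [/flattenP[c ccs zc]|nz] := boolP (z \in flatten cs).
    elim: (cs) uf ccs {fx} (inu) (cg) => //= d ds IH.
    rewrite cat_uniq inE => /and3P[ud /hasPn dis uds] cds inu' cg'.
    have du : {subset d <= u} by move=> y; apply: inu'; rewrite mem_head.
    rewrite iE //; case: ifP => zd.
      rewrite ixE // -map_rot (nth_map x0) ?size_rot ?index_mem //.
      rewrite -(cg' d (mem_head _ _)) (nth_map x0) ?index_mem // nth_index //.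
    case/predU1P: cds => [cd|cds]; first by rewrite -cd zc in zd.
    by apply: IH => // [e y eds|e eds]; [apply: inu'|apply: cg']; rewrite inE eds orbT.
  rewrite fx //; elim: (cs) nz (inu) => //= d ds IH; rewrite mem_cat negb_or => /andP[zd zds] inu'.
  rewrite iE ?(negPf zd) //; last by move=> y; apply: inu'; rewrite mem_head.
  by apply: IH => // e y eds; apply: inu'; rewrite inE eds orbT.
have gu z : z \in u -> g z \in u.
  move=> zu; have [/flattenP[c ccs zc]|nz] := boolP (z \in flatten cs); last by rewrite fx.
  by apply: (inu c) => //; apply: perm_in_flatten (cg c ccs) zc.
split.
- by rewrite size_map size_iota.
- move=> i iu; rewrite (nth_map 0%N) ?size_iota ?(leq_trans iu) // nth_iota ?(leq_trans iu) //.
  rewrite add0n; have := next _ (mem_nth x0 iu); rewrite index_uniq // => ->.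
  by rewrite index_mem nth_index ?gu ?mem_nth.
- move=> i ui iN; rewrite (nth_map 0%N) ?size_iota // nth_iota // add0n.
  elim: (cs) inu => //= d ds IH inu'; case: ifP => [/mapP[z zd iE']|_].
    by move: ui; rewrite iE' leqNgt index_mem (inu' d) // mem_head.
  by apply: IH => e y eds; apply: inu'; rewrite inE eds orbT.
- by move=> z zu; apply: fx; apply: contra zu => /sub.
Qed.

End Represent.

Definition has_prime_elt (T : finType) (H : {group {perm T}}) (p k : nat) : Prop :=
  exists2 g, g \in H & #|supp g| = k /\ g ^+ p = 1.

Lemma represents_prime (T : finType) N x0 (u : seq T) p k l g (H : {group {perm T}}) :
    uniq u -> size u <= N -> represents N x0 u l g -> lprime N p k l -> g \in H ->
  has_prime_elt H p k.
Proof.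
move=> uu uN rep /andP[/eqP mk /eqP m0] gh; exists g => //.
rewrite (represents_moved uu uN rep); split=> //; apply: card_supp0.
by rewrite (represents_moved uu uN (representsX uN p rep)).
Qed.

(** * Elements of small support in 2-transitive groups *)

Ltac card_lia :=
  repeat match goal with |- context [card ?A] => generalize (card A); intro end;
  repeat match goal with |- context [size ?s] => generalize (size s); intro end;
  clear; lia.

Section SmallSupport.

Variable T : finType.
Implicit Types (g h x y : {perm T}) (H : {group {perm T}}) (a b c d z : T).

Lemma map_traject_rot x a p : iter p x a = a -> map x (traject x a p) = rot 1 (traject x a p).
Proof.
case: p => // q; rewrite iterSr => E.
rewrite [in RHS]trajectS rot1_cons -[X in rcons _ X]E -trajectSr.
by elim: q.+1 (a) => //= n IH c; rewrite IH.
Qed.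

Lemma traject_prime x p a : prime p -> x ^+ p = 1 -> x a != a ->
  uniq (traject x a p) /\ map x (traject x a p) = rot 1 (traject x a p).
Proof.
move=> pr xp xa; split.
  apply/(uniqP a) => i j; rewrite !inE size_traject => ip jp.
  rewrite !nth_traject // -!permX.
  wlog ij : i j ip jp / i <= j.
    by case/orP: (leq_total i j) => le W E; [|symmetry]; apply: W.
  rewrite -{1}(subnK ij) expgD permM => /perm_inj E.
  apply/eqP; rewrite eqn_leq ij /= -subn_eq0; apply: contraNT xa; rewrite -lt0n => d0.
  have cop : coprime (j - i) p.
    by rewrite coprime_sym prime_coprime // gtnNdvd // (leq_ltn_trans (leq_subr i j)).
  (* By Bezout, [x] is a power of [x ^+ (j - i)], which fixes [a]. *)
  have [km kn E' _] := egcdnP p d0; rewrite (eqP cop) in E'.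
  have <- : x ^+ (km * (j - i)) = x.
    by rewrite E' expgD mulnC expgM xp expg1n mul1g.
  by rewrite mulnC expgM permX_fix.
by apply: map_traject_rot; rewrite -permX xp perm1.
Qed.

Lemma has_cycles_traject x p a : prime p -> x ^+ p = 1 -> #|supp x| = p -> a \in supp x ->
  has_cycles x [:: traject x a p] /\ supp x =i traject x a p.
Proof.
move=> pr xp sx; rewrite inE => xa; have [u cyc] := traject_prime pr xp xa.
have E : supp x =i traject x a p.
  apply: fsym; apply/subset_cardP; first by rewrite sx (card_uniqP u) size_traject.
  apply/subsetP => z /trajectP[i _ ->]; rewrite inE -!permX -permM.
  by rewrite -(commuteX i (commute_refl x)) permM (inj_eq perm_inj).
split=> //; apply/has_cyclesP; split; rewrite /= ?cats0 //.
- by move=> c; rewrite inE => /eqP->.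
- by move=> z; rewrite -E inE negbK => /eqP.
Qed.

Lemma represents_two H N (x0 : T) (u : seq T) x y csx csy w :
    uniq u -> size u <= N -> x \in H -> y \in H -> has_cycles x csx -> has_cycles y csy ->
    {subset flatten csx <= u} -> {subset flatten csy <= u} -> all (fun k => k < 2) w ->
  exists2 g, g \in H &
    represents N x0 u (lword N [:: lperm_of_cycles N (map (map (index^~ u)) csx);
                                lperm_of_cycles N (map (map (index^~ u)) csy)] w) g.
Proof.
move=> uu uN xh yh cx cy sx sy w2; exists (\prod_(k <- w) nth 1 [:: x; y] k).
  by apply: group_prod => -[|[|k]] _ //=; rewrite nth_nil group1.
apply: represents_word => // -[|[|k]] // _; exact: represents_cycles.
Qed.

(* Found by search: two 5-cycles whose supports share one to three points generate a group
   in which the 3-part of one of these words is a 3-cycle. *)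
Definition words5 : seq (seq nat) :=
  [:: [:: 0; 0; 1; 0; 1; 1; 0; 1]; [:: 0; 0; 0; 1]; [:: 0; 0; 0; 1; 0; 1; 0; 1];
      [:: 0; 0; 1; 0; 1; 1; 1]; [:: 0; 0; 1]; [:: 0; 0; 0; 0; 1]; [:: 0; 1];
      [:: 0; 1; 1]; [:: 0; 0; 0; 0; 1; 1; 1; 1; 0; 1]]%N.

(** Up to renaming, the first 5-cycle is [0 1 2 3 4] and the second starts at a common point 0, so
    at most 9 points occur. The other four entries of the second run through all possibilities. *)
Lemma words5_check :
  all (fun l1 => all (fun l2 => all (fun l3 => all (fun l4 =>
    let l := [:: 0; l1; l2; l3; l4]%N in
    uniq l && (count (fun i => i < 5) l <= 3) ==>
    has (fun w => lprime 9 3 3 (lword280 9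
      [:: lperm_of_cycles 9 [:: iota 0 5]; lperm_of_cycles 9 [:: l]] w)) words5)
    (iota 0 9)) (iota 0 9)) (iota 0 9)) (iota 0 9).
Proof. by vm_cast_no_check (erefl true). Qed.

Lemma uniq_cat_filter (A B : seq T) :
  uniq A -> uniq B -> uniq (A ++ [seq z <- B | z \notin A]).
Proof.
move=> uA uB; rewrite cat_uniq uA filter_uniq // andbT /=.
by apply/hasPn => z; rewrite mem_filter => /andP[].
Qed.

Lemma sub_cat_filter (A B : seq T) : {subset B <= A ++ [seq z <- B | z \notin A]}.
Proof. by move=> z zB; rewrite mem_cat mem_filter zB andbT orbN. Qed.

Lemma size_cat_filter (A B : seq T) :
  (size (A ++ [seq z <- B | z \notin A]) + count (mem A) B = size A + size B)%N.
Proof.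
rewrite size_cat -addnA; congr addn; rewrite size_filter addnC.
by rewrite -[RHS](count_predC (mem A)).
Qed.

Lemma map_index_cat (A C : seq T) : uniq A -> map (index^~ (A ++ C)) A = iota 0 (size A).
Proof.
move=> uA; apply: (@eq_from_nth _ 0%N); rewrite size_map ?size_iota // => i iA.
case: A uA iA => // a A uA iA.
by rewrite (nth_map a) // nth_iota // index_cat mem_nth // index_uniq.
Qed.

Lemma count_index_cat (A C B : seq T) :
  count (fun i => i < size A) (map (index^~ (A ++ C)) B) = count (mem A) B.
Proof.
rewrite count_map; apply: eq_count => z /=; rewrite index_cat.
case: ifP => zA; first by rewrite index_mem zA.
by apply/negbTE; rewrite -leqNgt leq_addr.
Qed.

Lemma uniq_map_index (u B : seq T) : {subset B <= u} -> uniq B -> uniq (map (index^~ u) B).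
Proof.
move=> sB uB; rewrite map_inj_in_uniq // => y z yB zB.
by move/(congr1 (nth y u)); rewrite !nth_index ?sB.
Qed.

Lemma five_cycles_meet H x y a :
    x \in H -> y \in H -> x ^+ 5 = 1 -> y ^+ 5 = 1 -> #|supp x| = 5 -> #|supp y| = 5 ->
    a \in supp x -> a \in supp y -> #|supp x :&: supp y| <= 3 ->
  has_prime_elt H 3 3.
Proof.
move=> xh yh x5 y5 sx sy ax ay I3.
have [cx Ex] := has_cycles_traject (isT : prime 5) x5 sx ax.
have [cy Ey] := has_cycles_traject (isT : prime 5) y5 sy ay.
set A := traject x a 5 in cx Ex; set B := traject y a 5 in cy Ey.
have [uA uB] : uniq A /\ uniq B.
  rewrite inE in ax; rewrite inE in ay.
  by have [? _] := traject_prime (isT : prime 5) x5 ax;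
     have [? _] := traject_prime (isT : prime 5) y5 ay.
pose u := A ++ [seq z <- B | z \notin A].
have uu : uniq u by apply: uniq_cat_filter.
have cAB : count (mem A) B = #|supp x :&: supp y|.
  rewrite -size_filter -(card_uniqP (filter_uniq (mem A) uB)); apply: eq_card => z.
  by rewrite mem_filter in_setI Ex Ey.
have aI : a \in supp x :&: supp y by rewrite in_setI ax ay.
have I0 : 0 < #|supp x :&: supp y| by apply/card_gt0P; exists a.
have szu : size u <= 9.
  have := size_cat_filter A B; rewrite -/u !size_traject cAB.
  by move: I0; card_lia.
have BE : map (index^~ u) B = [:: 0; index (y a) u; index (y (y a)) u;
     index (y (y (y a))) u; index (y (y (y (y a)))) u]%N.
  by rewrite /B /= eqxx.
have subB : {subset B <= u} := @sub_cat_filter A B.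
have subA : {subset A <= u} by move=> z zA; rewrite mem_cat zA.
have uI : uniq (map (index^~ u) B) by apply: uniq_map_index.
have cI : count (fun i => i < 5) (map (index^~ u) B) <= 3.
  by rewrite (@count_index_cat A _ B) cAB.
have lt9 z : z \in B -> index z u \in iota 0 9.
  by move=> zB; rewrite mem_iota leq0n; apply: leq_trans szu; rewrite index_mem subB.
have AE : map (index^~ u) A = iota 0 5 by rewrite map_index_cat.
have c1 := allP words5_check _ (lt9 (y a) (mem_nth a (isT : 1 < size B))).
have c2 := allP c1 _ (lt9 (y (y a)) (mem_nth a (isT : 2 < size B))).
have c3 := allP c2 _ (lt9 (y (y (y a))) (mem_nth a (isT : 3 < size B))).
have c4 := allP c3 _ (lt9 (y (y (y (y a)))) (mem_nth a (isT : 4 < size B))).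
cbv beta zeta in c4; rewrite -BE uI cI in c4.
have /hasP[w ww ok] := c4.
have w2 : all (fun k => k < 2) w.
  by move: w ww {ok}; apply/allP.
have fA : {subset flatten [:: A] <= u} by move=> z; rewrite [flatten _]cats0; apply: subA.
have fB : {subset flatten [:: B] <= u} by move=> z; rewrite [flatten _]cats0; apply: subB.
have [g gh rep] := represents_two a uu szu xh yh cx cy fA fB w2.
apply: (@represents_prime T 9 a u 3 3 _ (((g ^+ 8) ^+ 5) ^+ 7) H uu szu _ ok).
  by rewrite -AE /lword280; do 3!apply: (representsX szu).
by rewrite !groupX.
Qed.

Lemma suppJ x g : supp (x ^ g) = g @: supp x.
Proof.
apply/setP => z; rewrite -[z](permKV g) mem_imset; last exact: perm_inj.
by rewrite !inE permJ (inj_eq perm_inj).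
Qed.

Lemma card_suppJ x g : #|supp (x ^ g)| = #|supp x|.
Proof. by rewrite suppJ card_imset //; apply: perm_inj. Qed.

Lemma has_prime_elt_dec H p k : has_prime_elt H p k \/ ~ has_prime_elt H p k.
Proof.
have [/existsP[g /and3P[gh /eqP sg /eqP gp]]|/existsPn ne] :=
    boolP [exists g, [&& g \in H, #|supp g| == k & g ^+ p == 1]].
  by left; exists g.
by right=> -[g gh [sg gp]]; have := ne g; rewrite gh sg gp !eqxx.
Qed.

Lemma supp_stable x z : z \in supp x -> x z \in supp x.
Proof. by rewrite !inE (inj_eq perm_inj). Qed.

Lemma two_transitive_suppJ H x a c : two_transitive H -> x \in H -> a \in supp x -> a != c ->
  exists g, [/\ g \in H, a \in supp (x ^ g) & c \in supp (x ^ g)].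
Proof.
move=> tr xh ax ac; have xa : a != x a by move: ax; rewrite inE eq_sym.
have [g [gh ga gc]] := tr _ _ _ _ xa ac; exists g; split=> //.
  by rewrite suppJ -{1}ga imset_f.
by rewrite suppJ -gc imset_f ?supp_stable.
Qed.

(** Without 3-cycles, the supports of two conjugates of [x] with a common point share at least 4
    points. Let [E = supp x], let [F = supp y] contain [a] and a point [p] outside [E], and let [G]
    contain [a] and a point [q] outside [E] and [F]. Then [G] is [F] with [p] replaced by [q]. But
    the image of [E] under [y] meets [G] and misses its points [y p] and [q], so the two share at
    most 3 points. *)
Lemma two_transitive_five_cycle H : two_transitive H -> 7 <= #|T| ->
  has_prime_elt H 5 5 -> has_prime_elt H 3 3.
Proof.
move=> tr T7 [x xh [sx x5]]; have [//|n3] := has_prime_elt_dec H 3 3.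
have J g : g \in H -> [/\ x ^ g \in H, (x ^ g) ^+ 5 = 1 & #|supp (x ^ g)| = 5].
  by move=> gh; rewrite groupJ // -conjXg x5 conj1g card_suppJ.
have meet g h a : g \in H -> h \in H -> a \in supp (x ^ g) -> a \in supp (x ^ h) ->
    4 <= #|supp (x ^ g) :&: supp (x ^ h)|.
  move=> gh hh ag ah; rewrite leqNgt; apply/negP => lt.
  have [gH g5 sg] := J g gh; have [hH h5 sh] := J h hh.
  by apply: n3; apply: (five_cycles_meet gH hH g5 h5 sg sh ag ah).
have /card_gt0P[a ax] : 0 < #|supp x| by rewrite sx.
set E := supp x in sx ax.
have ltT (A : {set T}) : #|A| < #|T| -> exists z, z \notin A.
  move=> lt; apply/existsP; rewrite -negb_forall; apply: contraL lt => /forallP all_A.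
  by rewrite -leqNgt; apply/subset_leq_card/subsetP => z _; apply: all_A.
have [|p pE] := ltT E; first by rewrite sx; apply: leq_trans T7.
have [|g [gh ag pg]] := two_transitive_suppJ tr xh ax (c := p).
  by apply: contraNneq pE => <-.
set y := x ^ g; set F := supp y in ag pg; have [yh _ sF] := J g gh; rewrite -/y -/F in yh sF.
have EF : 4 <= #|E :&: F|.
  by move: (meet 1 g a (group1 H) gh); rewrite conjg1; apply.
have UF : #|E :|: F| <= 6 by rewrite cardsU sx sF; move: EF; card_lia.
have [|q qEF] := ltT (E :|: F); first exact: leq_ltn_trans UF T7.
move: qEF; rewrite inE negb_or => /andP[qE qF].
have [|h [hh ah qh]] := two_transitive_suppJ tr xh ax (c := q).
  by apply: contraNneq qE => <-.
have [_ _ sG] := J h hh.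
have EG : 4 <= #|E :&: supp (x ^ h)|.
  by move: (meet 1 h a (group1 H) hh); rewrite conjg1; apply.
have FG : 4 <= #|F :&: supp (x ^ h)| by apply: (meet g h a).
move: sG EG FG ah qh (fun z => meet y h z yh hh); set G := supp (x ^ h) => sG EG FG aG qG meetG.
(* Otherwise [G] would contain [p], [q] and at least 4 points of [E]. *)
have pG : p \notin G.
  apply: contraL (EG) => pG; rewrite -ltnNge ltnS.
  have : #|E :&: G :|: [set p; q]| <= 5.
    rewrite -sG; apply/subset_leq_card/subsetP => z; rewrite in_setU in_setI in_set2.
    by case/orP=> [/andP[]|/orP[]/eqP->].
  rewrite cardsU cards2 (_ : p != q); last by apply: contraNneq qF => <-.
  rewrite (_ : _ :&: [set p; q] = set0) ?cards0; last first.
    apply/setP => z; rewrite !in_setI in_set2 in_set0; apply/negbTE.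
    by apply/negP => /andP[/andP[zE _] /orP[]/eqP zE']; rewrite zE' ?(negPf pE) ?(negPf qE) in zE.
  by rewrite subn0; move: EG; card_lia.
have FpG z : z \in F -> z != p -> z \in G.
  have E1 : F :&: G = F :\ p.
    apply/eqP; rewrite eqEcard; apply/andP; split.
      by apply/subsetP => w; rewrite in_setI in_setD1 => /andP[-> wG]; rewrite andbT; apply: contraNneq pG => <-.
    by move: (cardsD1 p F) FG; rewrite pg sF; card_lia.
  move=> zF zp; have: z \in F :\ p by rewrite in_setD1 zp.
  by rewrite -E1 => /setIP[].
have Ey w : (w \in E) = (y w \in supp (x ^ y)) by rewrite suppJ mem_imset //; apply: perm_inj.
have eG : y p \in G.
  by apply: FpG; [apply: supp_stable|rewrite inE in pg].
have eE' : y p \notin supp (x ^ y) by rewrite -Ey.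
have qE' : q \notin supp (x ^ y).
  have yq : y q = q by move: qF; rewrite inE negbK => /eqP.
  by rewrite -yq -Ey.
(* The image under [y] of such a point lies in [G], because it is not [p], and in the image of [E];
   so the two supports do meet. *)
have [w /setD1P[wp /setIP[wE wF]]] : exists w, w \in (E :&: F) :\ y^-1 p.
  apply/card_gt0P; move: (cardsD1 (y^-1 p) (E :&: F)) EF; case: (_ \in _); card_lia.
have ywG : y w \in G.
  by apply: FpG; [apply: supp_stable|apply: contra wp => /eqP <-; rewrite permK].
have := meetG _ _ ywG; rewrite -Ey wE => /(_ isT).
have sub : supp (x ^ y) :&: G \subset G :\ y p :\ q.
  apply/subsetP => z; rewrite in_setI !in_setD1 => /andP[zE' ->]; rewrite andbT.
  by apply/andP; split; [apply: contraNneq qE' | apply: contraNneq eE'] => <-.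
have := subset_leq_card sub.
have := cardsD1 (y p) G; have := cardsD1 q (G :\ y p).
rewrite in_setD1 qG eG sG (_ : q != y p); first card_lia.
by apply: contraNneq qF => ->; apply: supp_stable.
Qed.

End SmallSupport.

(** * Products of two disjoint transpositions *)

Section DoubleTranspositions.

Variable T : finType.
Implicit Types (g h x y : {perm T}) (H : {group {perm T}}) (a b c d z : T) (B : {set T}).

Lemma double_transp_cycles x a : x ^+ 2 = 1 -> #|supp x| = 4 -> a \in supp x ->
  exists c, let A := [:: a; x a; c; x c] in
    [/\ uniq A, has_cycles x [:: [:: a; x a]; [:: c; x c]] & supp x =i A].
Proof.
move=> x2 sx ax; have xx z : x (x z) = z by move: (permX x z 2); rewrite x2 perm1.
have [c /setD1P[cxa /setD1P[ca cx]]] : exists c, c \in (supp x) :\ a :\ x a.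
  apply/card_gt0P; move: (cardsD1 a (supp x)) (cardsD1 (x a) (supp x :\ a)).
  by rewrite ax sx; case: (_ \in _); card_lia.
have xa : x a != a by rewrite inE in ax.
have xc : x c != c by rewrite inE in cx.
have u : uniq [:: a; x a; c; x c].
  have axc : a != x c by rewrite -[a]xx (inj_eq perm_inj) eq_sym.
  rewrite /= !inE !negb_or (inj_eq perm_inj) axc (eq_sym a (x a)) xa (eq_sym a c) ca.
  by rewrite (eq_sym (x a)) cxa (eq_sym c) xc.
have E : supp x =i [:: a; x a; c; x c].
  apply: fsym; apply/subset_cardP; first by rewrite sx (card_uniqP u).
  by apply/subsetP => z; rewrite !in_cons in_nil orbF => /or4P[]/eqP-> //; apply: supp_stable.
exists c; split=> //; apply/has_cyclesP; split=> //.
- by move=> e; rewrite !inE => /orP[]/eqP->; rewrite /= xx.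
- by move=> z; rewrite [flatten _]/= -E inE negbK => /eqP.
Qed.

(** Supports with an odd number of common points cover at most 7 points. With one common point the
    square of the product is a 3-cycle; with three the product is a 3-cycle or a 5-cycle. *)
Lemma words4_check :
  (all (fun l1 => all (fun l2 => all (fun l3 => all (fun l4 =>
    let l := [:: l1; l2; l3; l4] in
    let gs := [:: lperm_of_cycles 7 [:: [:: 0; 1]; [:: 2; 3]];
                  lperm_of_cycles 7 [:: [:: l1; l2]; [:: l3; l4]]] in
    let k := count (fun i => i < 4) l in
    uniq l ==>
    ((k == 1%N) ==> lprime 7 3 3 (lword 7 gs [:: 0; 1; 0; 1])) &&
    ((k == 3%N) ==> (lprime 7 3 3 (lword 7 gs [:: 0; 1]) || lprime 7 5 5 (lword 7 gs [:: 0; 1]))))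
    (iota 0 7)) (iota 0 7)) (iota 0 7)) (iota 0 7))%N.
Proof. by vm_cast_no_check (erefl true). Qed.

Lemma double_transp_meet H x y : two_transitive H -> 7 <= #|T| -> ~ has_prime_elt H 3 3 ->
    x \in H -> y \in H -> x ^+ 2 = 1 -> y ^+ 2 = 1 -> #|supp x| = 4 -> #|supp y| = 4 ->
  ~~ odd #|supp x :&: supp y|.
Proof.
move=> tr T7 n3 xh yh x2 y2 sx sy; apply/negP => oI.
have n5 : ~ has_prime_elt H 5 5 by move/(two_transitive_five_cycle tr T7).
have /card_gt0P[a ax] : 0 < #|supp x| by rewrite sx.
have /card_gt0P[b bx] : 0 < #|supp y| by rewrite sy.
have [a' [uA cx Ex]] := double_transp_cycles x2 sx ax.
have [b' [uB cy Ey]] := double_transp_cycles y2 sy bx.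
set A := [:: a; x a; a'; x a'] in uA Ex; set B := [:: b; y b; b'; y b'] in uB Ey.
pose u := A ++ [seq z <- B | z \notin A].
have uu : uniq u by apply: uniq_cat_filter.
have cAB : count (mem A) B = #|supp x :&: supp y|.
  rewrite -size_filter -(card_uniqP (filter_uniq (mem A) uB)); apply: eq_card => z.
  by rewrite mem_filter in_setI Ex Ey.
have szu : size u <= 7.
  move: (size_cat_filter A B) oI; rewrite -/u cAB -[size A]/4 -[size B]/4.
  by case: #|_| => // k; card_lia.
have subB : {subset B <= u} := @sub_cat_filter _ A B.
have subA : {subset A <= u} by move=> z zA; rewrite mem_cat zA.
have uI : uniq (map (index^~ u) B) by apply: uniq_map_index.
have lt7 z : z \in B -> index z u \in iota 0 7.
  by move=> zB; rewrite mem_iota leq0n; apply: leq_trans szu; rewrite index_mem subB.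
have c1 := allP words4_check _ (lt7 b (mem_nth a (isT : 0 < size B))).
have c2 := allP c1 _ (lt7 (y b) (mem_nth a (isT : 1 < size B))).
have c3 := allP c2 _ (lt7 b' (mem_nth a (isT : 2 < size B))).
have c4 := allP c3 _ (lt7 (y b') (mem_nth a (isT : 3 < size B))).
cbv beta zeta in c4.
have AE : map (index^~ u) A = iota 0 4 by rewrite map_index_cat.
have AE' : map (map (index^~ u)) [:: [:: a; x a]; [:: a'; x a']] = [:: [:: 0; 1]; [:: 2; 3]]%N.
  by rewrite -[LHS]/[:: take 2 (map (index^~ u) A); drop 2 (map (index^~ u) A)] AE.
have w v : all (fun k => k < 2) v -> exists2 g, g \in H & represents 7 a u (lword 7
    [:: lperm_of_cycles 7 [:: [:: 0; 1]; [:: 2; 3]];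
        lperm_of_cycles 7 (map (map (index^~ u)) [:: [:: b; y b]; [:: b'; y b']])] v)%N g.
  by rewrite -AE'; exact: (represents_two a uu szu xh yh cx cy subA subB).
have cI := @count_index_cat _ A [seq z <- B | z \notin A] B; rewrite -/u cAB in cI.
rewrite -[[:: index b u; _; _; _]]/(map (index^~ u) B) uI [count _ _]cI in c4.
have I4 : #|supp x :&: supp y| <= 4 by rewrite -sx subset_leq_card // subsetIl.
case/andP: c4; move: oI I4; case: #|_| => [|[|[|[|[|]]]]] //= _ _ k1 k3.
- have [g gh rep] := w [:: 0; 1; 0; 1]%N isT.
  by apply: n3; apply: (represents_prime uu szu rep k1 gh).
- have [g gh rep] := w [:: 0; 1]%N isT.
  case/orP: k3 => k3; [apply: n3|apply: n5]; exact: (represents_prime uu szu rep k3 gh).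
Qed.

Lemma card4_enum B a c : #|B| = 4 -> a \in B -> c \in B -> a != c ->
  exists e f, uniq [:: a; c; e; f] /\ B =i [:: a; c; e; f].
Proof.
move=> B4 aB cB ac.
have c1 : c \in B :\ a by rewrite in_setD1 eq_sym ac.
have sz : #|B :\ a :\ c| = 2.
  by move: (cardsD1 a B) (cardsD1 c (B :\ a)); rewrite aB c1 B4; card_lia.
have /cards2P[e [f [ef E]]] : #|B :\ a :\ c| == 2 by rewrite sz.
exists e, f; have u : uniq [:: a; c; e; f].
  have: e \in B :\ a :\ c by rewrite E !inE eqxx.
  have: f \in B :\ a :\ c by rewrite E !inE eqxx orbT.
  rewrite !in_setD1 /= !inE !negb_or ac ef => /and3P[fc fa _] /and3P[ec ea _].
  by rewrite !(eq_sym a) ea fa !(eq_sym c) ec fc.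
split=> // z; apply/idP/idP => [zB|].
  have [->|za] := eqVneq z a; first exact: mem_head.
  have [->|zc] := eqVneq z c; first by rewrite !inE eqxx orbT.
  have: z \in B :\ a :\ c by rewrite !in_setD1 za zc.
  by rewrite E !inE => /orP[]/eqP->; rewrite eqxx ?orbT.
rewrite !inE => /or4P[]/eqP-> //.
- by have /setD1P[_ /setD1P[_ ->]] : e \in B :\ a :\ c by rewrite E !inE eqxx.
- by have /setD1P[_ /setD1P[_ ->]] : f \in B :\ a :\ c by rewrite E !inE eqxx orbT.
Qed.

Lemma card_setI_enum B B' (s : seq T) : uniq s -> B =i s -> #|B :&: B'| = count (mem B') s.
Proof.
move=> us E; rewrite -size_filter -(card_uniqP (filter_uniq (mem B') us)).
by apply: eq_card => z; rewrite mem_filter in_setI E andbC.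
Qed.

Lemma count_mem_card B (s : seq T) : uniq s -> count (mem B) s <= #|B|.
Proof.
move=> us; rewrite -size_filter -(card_uniqP (filter_uniq (mem B) us)).
by apply/subset_leq_card/subsetP => z; rewrite mem_filter => /andP[].
Qed.

Lemma count_mem_setI B B' (s : seq T) : uniq s -> count (mem B) s = #|B| ->
  #|B :&: B'| = count (fun z => (z \in B) && (z \in B')) s.
Proof.
move=> us E; have us' := filter_uniq (mem B) us.
have EB : B =i filter (mem B) s.
  apply: fsym; apply/subset_cardP; first by rewrite (card_uniqP us') size_filter.
  by apply/subsetP => z; rewrite mem_filter => /andP[].
rewrite (card_setI_enum B' us' EB) count_filter; apply: eq_count => z /=.
by rewrite andbC.
Qed.

(* Without 3-cycles, the supports of the conjugates of a double transposition are 4-sets that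
   pairwise meet evenly and cover each pair of points; this confines them to at most 8 points,
   as the planes of the affine space of order 2 and dimension 3. *)
Lemma two_transitive_double_transp H : two_transitive H -> 9 <= #|T| ->
  has_prime_elt H 2 4 -> has_prime_elt H 3 3.
Proof.
move=> tr T9 [x xh [sx x2]]; have [//|n3] := has_prime_elt_dec H 3 3.
pose blk B := exists2 g, g \in H & B = supp (x ^ g).
have blk4 B : blk B -> #|B| = 4 by case=> g _ ->; rewrite card_suppJ.
have ev B B' : blk B -> blk B' -> ~~ odd #|B :&: B'|.
  case=> g gh -> [h hh ->]; have T7 : 7 <= #|T| by apply: leq_trans T9.
  apply: (double_transp_meet tr T7 n3); rewrite ?groupJ // ?card_suppJ //.
    by rewrite -conjXg x2 conj1g.
  by rewrite -conjXg x2 conj1g.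
have pair a c : a != c -> exists B, [/\ blk B, a \in B & c \in B].
  move=> ac; have /card_gt0P[z zx] : 0 < #|supp x| by rewrite sx.
  have zxz : z != x z by move: zx; rewrite inE eq_sym.
  have [g [gh ga gc]] := tr _ _ _ _ zxz ac.
  exists (supp (x ^ g)); split; first by exists g.
    by rewrite suppJ -ga imset_f.
  by rewrite suppJ -gc imset_f ?supp_stable.
have ltT (s : seq T) : size s < #|T| -> exists z, z \notin s.
  move=> lt; apply/existsP; rewrite -negb_forall; apply: contraL lt => /forallP all_s.
  rewrite -leqNgt; apply: leq_trans (card_size s).
  by apply/subset_leq_card/subsetP => z _; apply: all_s.
(* A block through [a] and [b] misses some [z]; an element carrying [a], [z] to [a], [b] turns it
   into a block that contains [a] but not [b]. *)
have sep a b : a != b -> exists B, [/\ blk B, a \in B & b \notin B].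
  move=> ab; have [B [[g gh EB] aB bB]] := pair a b ab.
  have [|z zB] := ltT (enum B).
    by rewrite -cardE (blk4 B); [apply: leq_trans T9 | exists g].
  rewrite mem_enum in zB.
  have az : a != z by apply: contraNneq zB => <-.
  have [h [hh ha hz]] := tr _ _ _ _ az ab.
  exists (h @: B); split.
  - by exists (g * h); rewrite ?groupM // EB conjgM (suppJ (x ^ g) h).
  - by rewrite -ha imset_f.
  - by rewrite -hz mem_imset //; apply: perm_inj.
have par B B' (s : seq T) : blk B -> blk B' -> uniq s -> B =i s -> ~~ odd (count (mem B') s).
  by move=> bB bB' us E; rewrite -(card_setI_enum B' us E); apply: ev.
have /card_gt0P[a _] : 0 < #|T| by apply: leq_trans T9.
have [|b0] := ltT [:: a]; first exact: leq_trans T9.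
rewrite inE eq_sym => ab0.
(* By parity and renaming, three blocks take the form [a b c d1], [a c e f], [a b e g] on seven
   distinct points. Without [a] they are three lines of the Fano plane that do not pass through one
   point. *)
have [B1 [bB1 aB1 b0B1]] := pair a b0 ab0.
have [c0 [d0 [u1 E1]]] := card4_enum (blk4 _ bB1) aB1 b0B1 ab0.
have [B2 [bB2 aB2 b0B2]] := sep a b0 ab0.
have [c [d {c0 d0 u1 E1} [u1 E1 cB2 dB2]]] : exists c d,
    [/\ uniq [:: a; b0; c; d], B1 =i [:: a; b0; c; d], c \in B2 & d \notin B2].
  have := par _ _ _ bB1 bB2 u1 E1; rewrite /= aB2 (negPf b0B2).
  have [cB2|cB2] := boolP (c0 \in B2); have [dB2|dB2] := boolP (d0 \in B2) => // _.
    by exists c0, d0.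
  have u' : uniq [:: a; b0; d0; c0].
    by rewrite (@perm_uniq _ _ [:: a; b0; c0; d0]) //; apply/seq.permP => P /=; clear; lia.
  by exists d0, c0; split=> // z; rewrite E1 !inE (orbC (z == c0)).
have ac : a != c by move: u1; rewrite /= !inE !negb_or => /andP[/and3P[]].
have [e0 [f0 [u2 E2]]] := card4_enum (blk4 _ bB2) aB2 cB2 ac.
have [B3 [bB3 aB3 cB3]] := sep a c ac.
have [e [f {e0 f0 u2 E2} [u2 E2 eB3 fB3]]] : exists e f,
    [/\ uniq [:: a; c; e; f], B2 =i [:: a; c; e; f], e \in B3 & f \notin B3].
  have := par _ _ _ bB2 bB3 u2 E2; rewrite /= aB3 (negPf cB3).
  have [eB|eB] := boolP (e0 \in B3); have [fB|fB] := boolP (f0 \in B3) => // _.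
    by exists e0, f0.
  have u' : uniq [:: a; c; f0; e0].
    by rewrite (@perm_uniq _ _ [:: a; c; e0; f0]) //; apply/seq.permP => P /=; clear; lia.
  by exists f0, e0; split=> // z; rewrite E2 !inE (orbC (z == e0)).
have [b [d1 {u1 E1} [u1 E1 bB2' d1B2 bB3']]] : exists b d',
    [/\ uniq [:: a; b; c; d'], B1 =i [:: a; b; c; d'], b \notin B2, d' \notin B2
      & (b \in B3) && (d' \notin B3)].
  have := par _ _ _ bB1 bB3 u1 E1; rewrite /= aB3 (negPf cB3).
  have [eB|eB] := boolP (b0 \in B3); have [fB|fB] := boolP (d \in B3) => // _.
    by exists b0, d; split; rewrite ?eB.
  have u' : uniq [:: a; d; c; b0].
    by rewrite (@perm_uniq _ _ [:: a; b0; c; d]) //; apply/seq.permP => P /=; clear; lia.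
  exists d, b0; split; rewrite ?fB // => z.
  by rewrite E1; apply: perm_mem; apply/seq.permP => P /=; clear; lia.
case/andP: bB3' => bInB3 d1B3.
have sep_ne z w B : z \in B -> w \notin B -> z != w by move=> zB; apply: contraNneq => <-.
have ab : a != b by move: u1; rewrite /= !inE !negb_or => /andP[/and3P[]].
have eb : e != b by apply: (@sep_ne _ _ B2) => //; rewrite E2 // !inE eqxx !orbT.
have ea : e != a by rewrite eq_sym; move: u2; rewrite /= !inE !negb_or => /andP[/and3P[]].
have [g [u3 E3]] : exists g : T, uniq [:: a; b; e; g] /\ B3 =i [:: a; b; e; g].
  have [s [t [u3 E3]]] := card4_enum (blk4 _ bB3) aB3 bInB3 ab.
  move: eB3; rewrite E3 !inE (negPf ea) (negPf eb) /= => /orP[]/eqP ->; first by exists t.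
  exists s; have u' : uniq [:: a; b; t; s].
    by rewrite (@perm_uniq _ _ [:: a; b; s; t]) //; apply/seq.permP => P /=; clear; lia.
  by split=> // z; rewrite E3 !inE (orbC (z == s)).
have gB3 : g \in B3 by rewrite E3 !inE eqxx !orbT.
have fB2 : f \in B2 by rewrite E2 !inE eqxx !orbT.
have eB2 : e \in B2 by rewrite E2 !inE eqxx !orbT.
have u7 : uniq [:: a; b; c; d1; e; f; g].
  have be : b != e by rewrite eq_sym.
  have bf : b != f by rewrite eq_sym (@sep_ne _ _ B2).
  have de : d1 != e by rewrite eq_sym (@sep_ne _ _ B2).
  have df : d1 != f by rewrite eq_sym (@sep_ne _ _ B2).
  have cg : c != g by rewrite eq_sym (@sep_ne _ _ B3).
  have dg : d1 != g by rewrite eq_sym (@sep_ne _ _ B3).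
  have fg : f != g by rewrite eq_sym (@sep_ne _ _ B3).
  move: u1 u2 u3; rewrite /= !inE !negb_or -!andbA.
  do ![case/andP=> ?]; move=> _; do ![case/andP=> ?]; move=> _; do ![case/andP=> ?]; move=> _.
  by do ![apply/andP; split].
have [p pn] := ltT [:: a; b; c; d1; e; f; g] (leq_trans (isT : 7 < 9) T9).
have [q qn] := ltT [:: p; a; b; c; d1; e; f; g] T9.
have u9 : uniq [:: q; p; a; b; c; d1; e; f; g] by rewrite cons_uniq qn cons_uniq pn u7.
have [ap aq] : a != p /\ a != q.
  move: u9; rewrite /= !inE !negb_or !(eq_sym _ a) => /andP[/and3P[_ -> _] /andP[/andP[-> _] _]].
  by [].
have [P [bP aP pP]] := pair a p ap.
have [Q [bQ aQ qQ]] := pair a q aq.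
(* [P] has two points besides [a] and [p], and it must meet each of the three lines oddly; this
   leaves only the pairs [c g], [b f] and [d1 e]. The same holds for [Q], so [P] and [Q] share [a]
   and none or two further points, an odd number. *)
have := count_mem_card P u9; have := count_mem_card Q u9.
have := @count_mem_setI P Q _ u9; have := ev _ _ bP bQ.
have := par _ _ _ bB1 bP u1 E1; have := par _ _ _ bB2 bP u2 E2; have := par _ _ _ bB3 bP u3 E3.
have := par _ _ _ bB1 bQ u1 E1; have := par _ _ _ bB2 bQ u2 E2; have := par _ _ _ bB3 bQ u3 E3.
rewrite (blk4 P bP) (blk4 Q bQ) /= aP pP aQ qQ.
case: (b \in P); case: (c \in P); case: (d1 \in P) => //; case: (e \in P); case: (f \in P) => //;
 case: (g \in P) => //; case: (q \in P) => //.
all: case: (b \in Q); case: (c \in Q); case: (d1 \in Q) => //; case: (e \in Q); case: (f \in Q) => //;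
 case: (g \in Q) => //; case: (p \in Q) => //.
all: by move=> _ _ _ _ _ _ oI /(_ (erefl _)) EI; rewrite EI in oI.
Qed.

End DoubleTranspositions.

(** * Products of two disjoint 3-cycles *)

Section TwoThreeCycles.

Variable T : finType.
Implicit Types (g h x y : {perm T}) (H : {group {perm T}}) (a b c d z : T) (B : {set T}).

Lemma two_three_cycles x : x ^+ 3 = 1 -> #|supp x| = 6 ->
  exists a c, let A := [:: a; x a; x (x a); c; x c; x (x c)] in
    uniq A /\ has_cycles x [:: [:: a; x a; x (x a)]; [:: c; x c; x (x c)]].
Proof.
move=> x3 sx; have /card_gt0P[a ax] : 0 < #|supp x| by rewrite sx.
have pr : prime 3 by [].
have xa : x a != a by rewrite inE in ax.
have [ua ca] := traject_prime pr x3 xa.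
have [c cx ca'] : exists2 c, c \in supp x & c \notin traject x a 3.
  apply/exists_inP; rewrite -negb_forall_in; apply: contraL (isT : 3 < 6) => /forall_inP sub.
  rewrite -leqNgt -sx; apply: leq_trans (card_size (traject x a 3)).
  by apply/subset_leq_card/subsetP => z /sub.
have xc : x c != c by rewrite inE in cx.
have [uc cc] := traject_prime pr x3 xc.
have dis z : z \in traject x c 3 -> z \notin traject x a 3.
  move=> zc; apply: contra ca' => za.
  have cc3 : c \in traject x c 3 by rewrite mem_head.
  have [m <-] := cycle_trans cc zc cc3.
  exact: permX_cycle_mem ca za.
have u : uniq (traject x a 3 ++ traject x c 3).
  by rewrite cat_uniq ua uc andbT; apply/hasPn => z /dis.
have E : supp x =i traject x a 3 ++ traject x c 3.
  apply: fsym; apply/subset_cardP; first by rewrite sx (card_uniqP u).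
  apply/subsetP => z; rewrite mem_cat => /orP[] zz; rewrite inE;
    rewrite -[x]expg1 (permX_cycle_fix 1 _ _ zz) ?size_traject //.
exists a, c; split; first exact: u.
apply/has_cyclesP; split; first exact: u.
- by move=> e; rewrite !inE => /orP[]/eqP->.
- by move=> z; rewrite -[flatten _]/(traject x a 3 ++ traject x c 3) -E inE negbK => /eqP.
Qed.

(** The two elements share the points 0, 1, 3, 5, so at most 8 points occur, and only [i] and [j]
    are unknown. In each case one of the three words is a 3-cycle or a double transposition. *)
Lemma words33_check :
 (all (fun i => all (fun j =>
    let gs := [:: lperm_of_cycles 8 [:: [:: 0; 1; 2]; [:: 3; 4; 5]];
                  lperm_of_cycles 8 [:: [:: 0; 1; i]; [:: 3; 5; j]]] in
    uniq [:: 0; 1; i; 3; 5; j] ==>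
    has (fun w => lprime 8 3 3 (lword 8 gs w) || lprime 8 2 4 (lword 8 gs w))
      [:: [:: 0; 1; 0; 1]; [:: 0; 0; 1; 0; 1; 1]; [:: 0; 0; 1; 0; 1]])
    (iota 0 8)) (iota 0 8))%N.
Proof. by vm_cast_no_check (erefl true). Qed.

(** 4-transitivity gives a conjugator that fixes [a], [x a], [c] and moves [x c] to [x (x c)]. Each
    cycle of the conjugate then has two known points in one cycle of [x]. *)
Lemma four_transitive_two_three_cycles H : ktransitive H 4 -> has_prime_elt H 3 6 ->
  has_prime_elt H 3 3 \/ has_prime_elt H 2 4.
Proof.
move=> tr [x xh [sx x3]]; have [a [c [uA cx]]] := two_three_cycles x3 sx.
set A := [:: a; x a; x (x a); c; x c; x (x c)] in uA.
have uP (s : seq nat) : uniq s -> all (fun i => i < 6) s -> uniq [seq nth a A i | i <- s].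
  move=> us /allP s6; rewrite map_inj_in_uniq // => i j /s6 i6 /s6 j6 /eqP.
  by rewrite nth_uniq // => /eqP.
have [g gh] := tr _ _ (uP [:: 0; 1; 3; 4]%N isT isT) (uP [:: 0; 1; 3; 5]%N isT isT) erefl erefl.
case=> ga gxa gc gxc; have cy := has_cyclesJ g cx; rewrite /= ga gxa gc gxc in cy.
set e := g (x (x a)) in cy; set f := g (x (x c)) in cy.
pose B := [:: a; x a; e; c; x (x c); f].
have [uB _ _] := has_cyclesP _ _ cy; rewrite -[flatten _]/B in uB.
pose u := A ++ [seq z <- B | z \notin A].
have uu : uniq u by apply: uniq_cat_filter.
have szu : size u <= 8.
  have ABc : 4 <= count (mem A) B.
    rewrite -size_filter; apply: (@uniq_leq_size _ [seq nth a A i | i <- [:: 0; 1; 3; 5]%N]).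
      exact: uP.
    by move=> z; rewrite mem_filter !inE => /or4P[]/eqP->; rewrite !eqxx ?orbT.
  by move: (size_cat_filter A B) ABc; rewrite -/u -[size A]/6 -[size B]/6; generalize (count (mem A) B); card_lia.
have subB : {subset B <= u} := @sub_cat_filter _ A B.
have subA : {subset A <= u} by move=> z zA; rewrite mem_cat zA.
have uI : uniq (map (index^~ u) B) by apply: uniq_map_index.
have lt8 z : z \in B -> index z u \in iota 0 8.
  by move=> zB; rewrite mem_iota leq0n; apply: leq_trans szu; rewrite index_mem subB.
have c1 := allP words33_check _ (lt8 e (mem_nth a (isT : 2 < size B))).
have c2 := allP c1 _ (lt8 f (mem_nth a (isT : 5 < size B))).
cbv beta zeta in c2.
have AE : map (index^~ u) A = iota 0 6 by rewrite map_index_cat.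
have AI i : i < 6 -> index (nth a A i) u = i.
  by move=> i6; rewrite index_cat mem_nth // index_uniq.
have xE : map (map (index^~ u)) [:: [:: a; x a; x (x a)]; [:: c; x c; x (x c)]]
    = [:: [:: 0; 1; 2]; [:: 3; 4; 5]]%N.
  by rewrite -[LHS]/[:: take 3 (map (index^~ u) A); drop 3 (map (index^~ u) A)] AE.
have yE : map (map (index^~ u)) [:: [:: a; x a; e]; [:: c; x (x c); f]]
    = [:: [:: 0; 1; index e u]; [:: 3; 5; index f u]]%N.
  rewrite -[LHS]/[:: [:: index (nth a A 0) u; index (nth a A 1) u; index e u];
                     [:: index (nth a A 3) u; index (nth a A 5) u; index f u]].
  by rewrite !AI.
have rp v : all (fun k => k < 2) v -> exists2 g, g \in H & represents 8 a u (lword 8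
    [:: lperm_of_cycles 8 [:: [:: 0; 1; 2]; [:: 3; 4; 5]];
        lperm_of_cycles 8 [:: [:: 0; 1; index e u]; [:: 3; 5; index f u]]] v)%N g.
  rewrite -xE -yE; apply: (represents_two a uu szu xh (groupJ xh gh) cx cy subA subB).
have uI' : uniq [:: 0; 1; index e u; 3; 5; index f u]%N.
  have -> : [:: 0; 1; index e u; 3; 5; index f u]%N = map (index^~ u) B.
    rewrite -[RHS]/[:: index (nth a A 0) u; index (nth a A 1) u; index e u;
      index (nth a A 3) u; index (nth a A 5) u; index f u].
    by rewrite !AI.
  exact: uI.
rewrite uI' in c2; have /hasP[w ww ok] := c2.
have w2 : all (fun k => k < 2) w by move: w ww {ok}; apply/allP.
have [k kh rep] := rp w w2.
by case/orP: ok => ok; [left|right]; exact: (represents_prime uu szu rep ok kh).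
Qed.

End TwoThreeCycles.

(** * Consequences of containing a cycle type *)

Section Exclusion.

Variable T : finType.
Implicit Types (g h x y : {perm T}) (H K : {group {perm T}}) (lam mu : seq nat).

Lemma has_type_prime_elt H lam m p k : has_type H lam ->
    sumn [seq l <- lam | ~~ (l %| m)] = k -> all (fun l => l %| m * p) lam ->
  has_prime_elt H p k.
Proof.
move=> [g gh ct] sk ap; exists (g ^+ m); first exact: groupX.
split; first by rewrite (card_supp_expg m ct).
apply: card_supp0; rewrite -expgM (card_supp_expg _ ct).
by rewrite (_ : filter _ _ = [::]) // -(filter_pred0 lam); apply/eq_in_filter => l /(allP ap) ->.
Qed.

(** The product of the odd lengths is an odd exponent that kills their cycles and leaves the two
    transpositions. *)
Lemma two_two_prime_elt H mu : all odd mu -> has_type H (2 :: 2 :: mu) -> has_prime_elt H 2 4.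
Proof.
move=> oddmu ht.
have dv l : l \in mu -> l %| foldr muln 1%N mu.
  elim: mu {oddmu ht} => //= a s IH; rewrite inE => /predU1P[->|/IH]; first exact: dvdn_mulr.
  exact: dvdn_mull.
have n2 : ~~ (2 %| foldr muln 1%N mu).
  rewrite dvdn2 negbK; elim: mu oddmu {ht dv} => //= a s IH /andP[na /IH].
  by rewrite oddM na.
apply: (@has_type_prime_elt H _ (foldr muln 1%N mu) _ _ ht).
  rewrite /= n2 /= (_ : filter _ _ = [::]) // -(filter_pred0 mu).
  by apply/eq_in_filter => l /dv ->.
rewrite /= dvdn_mull //=; apply/allP => l /dv; exact: dvdn_mulr.
Qed.

Lemma prime_elt3_type H : has_prime_elt H 3 3 -> exists k, has_type H (3 :: nseq k 1%N).
Proof.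
case=> x xh [sx x3]; have /card_gt0P[a ax] : 0 < #|supp x| by rewrite sx.
have [cx E] := has_cycles_traject (isT : prime 3) x3 sx ax.
exists (size (enum (~: supp x))), x => //.
exists (traject x a 3 :: [seq [:: z] | z <- enum (~: supp x)]).
have fl (s : seq T) : flatten [seq [:: z] | z <- s] = s by elim: s => //= z s ->.
have EE : flatten (traject x a 3 :: [seq [:: z] | z <- enum (~: supp x)])
   = traject x a 3 ++ enum (~: supp x) by rewrite -[RHS]/(_ ++ _) -[in RHS](fl (enum _)).
have full : flatten (traject x a 3 :: [seq [:: z] | z <- enum (~: supp x)]) =i predT.
  by move=> z; rewrite EE mem_cat mem_enum in_setC -E orbN.
have xa : x a != a by rewrite inE in ax.
have [ut ct] := traject_prime (isT : prime 3) x3 xa.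
split=> //; last by rewrite /=; congr (_ :: _); elim: (enum _) => //= z s ->.
apply/has_cyclesP; split.
- rewrite EE cat_uniq ut enum_uniq andbT; apply/hasPn => z.
  by rewrite mem_enum in_setC E.
- move=> c; rewrite inE => /predU1P[->//|/mapP[z]].
  by rewrite mem_enum in_setC inE negbK => /eqP zE ->; rewrite /= zE.
- by move=> z; rewrite full.
Qed.

Definition block_sums b l mu := exists2 r, 0 < r <= l & (r * b)%N \in map (addn l) (subset_sums mu).

Lemma three_cycle_block_size H : transitive_group H -> ~~ ('Alt_T \subset H) ->
    has_prime_elt H 3 3 ->
  exists b, [/\ 3 <= b, b %| #|T|, b.*2 <= #|T|,
    forall mu, all (fun l => ~~ (3 %| l)) mu -> has_type H (3 :: mu) ->
      b \in map (addn 3) (subset_sums mu)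
  & forall l mu, 0 < l -> has_type H (l :: mu) -> block_sums b l mu].
Proof.
move=> tr nA /prime_elt3_type[k]; apply: has_type_block_size => //.
by apply/allP => l /nseqP[->].
Qed.

(** An orbit and its complement are both stable; [k] is the size of the smaller one. *)
Lemma transitive_or_sums H : transitive_group H \/
  exists k, [/\ 0 < k, k.*2 <= #|T| & forall lam, has_type H lam -> k \in subset_sums lam].
Proof.
have [/forallP tr|] := boolP [forall a, [forall b, [exists g in H, (g : {perm T}) a == b]]].
  left=> a b; have /existsP[g /andP[gh /eqP E]] := forallP (tr a) b.
  by exists g.
rewrite negb_forall => /existsP[a]; rewrite negb_forall => /existsP[b nab]; right.
pose U := [set (g : {perm T}) a | g in H].
have stU g : g \in H -> {in U, forall z, g z \in U}.
  move=> gh z /imsetP[h hh ->]; apply/imsetP; exists (h * g); first exact: groupM.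
  by rewrite permM.
have stC g : g \in H -> {in ~: U, forall z, g z \in ~: U}.
  move=> gh z; rewrite !in_setC; apply: contra => /(stU _ (groupVr gh)).
  by rewrite permK.
have aU : a \in U by apply/imsetP; exists 1; rewrite ?perm1.
have bU : b \in ~: U.
  rewrite in_setC; apply: contra nab => /imsetP[g gh ->]; apply/existsP; exists g.
  by rewrite gh eqxx.
have [U0 C0] : 0 < #|U| /\ 0 < #|~: U| by split; apply/card_gt0P; [exists a|exists b].
have sz := cardsC U.
have [le|lt] := leqP #|U| #|~: U|.
  exists #|U|; split=> //; first by rewrite -sz -addnn leq_add2l.
  by move=> lam; apply: card_stable_subset_sums.
exists #|~: U|; split=> //; first by rewrite -sz -addnn leq_add2r ltnW.
by move=> lam; apply: card_stable_subset_sums.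
Qed.

Definition even_type (lam : seq nat) : bool :=
  [&& sumn lam == #|T|, all (leq 1) lam & odd #|T| == odd (size lam)].

Lemma even_type_cover H K lam :
    (forall x, x \in 'Alt_T -> exists2 g, g \in 'Alt_T & x ^ g \in H \/ x ^ g \in K) ->
    even_type lam ->
  has_type H lam \/ has_type K lam.
Proof.
move=> cov /and3P[/eqP s p /eqP o]; have [x xt] := exists_cycle_type s.
have xA : x \in 'Alt_T by rewrite Alt_even (odd_cycle_type p xt) o addbb.
by have [g _ [gH|gK]] := cov x xA; [left|right]; exists (x ^ g) => //; apply: has_cycle_typeJ.
Qed.

End Exclusion.

(** * Degree nine *)

Section NineCycles.

Variable T : finType.
Implicit Types (g h x y c d : {perm T}) (H K : {group {perm T}}) (lam mu : seq nat).

Definition affine9 (a b : nat) : seq nat := [seq (b + a * i) %% 9 | i <- iota 0 9]%N.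

Definition affine9_orbit (a b : nat) : seq nat := traject (nth 0%N (affine9 a b)) 0 9.

(** Each orbit is kept once, at its least element. *)
Definition list_cycles (p : seq nat) : seq (seq nat) :=
  let orb i := undup (traject (nth 0%N p) i (size p)) in
  [seq orb i | i <- iota 0 (size p) & all (leq i) (orb i)].

(** If the orbit [w] of 0 under an affine map of Z/9 is everything, this map is a 9-cycle and
    [i -> w_i] conjugates the translation by 1 into it. The essential claim is that this conjugator
    is even: its number of cycles is odd, like 9. *)
Lemma affine9_check :
  (all (fun a => all (fun b =>
     let w := affine9_orbit a b in
     let cs := list_cycles w in
     uniq w ==>
     [&& map (nth 0 (affine9 a b)) w == rot 1 w, all (fun i => i < 9) w,
         all (fun e => map (nth 0 w) e == rot 1 e) cs, uniq (flatten cs),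
         all (leq 1) (map size cs), perm_eq (flatten cs) (iota 0 9) & odd (size cs)])
   (iota 0 9)) (iota 0 9))%N.
Proof. by vm_compute. Qed.

Lemma nine_cycle_fix d m z : has_cycle_type d [:: 9] -> ((d ^+ m) z == z) = (9 %| m).
Proof.
case=> cs [cyc full sz]; have [us cg _] := has_cyclesP _ _ cyc.
case: cs full sz us cg {cyc} => [|s [|]] //; rewrite [flatten _]cats0 => full [szs] us cg.
by rewrite (permX_cycle_fix m (cg s (mem_head _ _))) ?szs ?full.
Qed.

Lemma normalized_nine_cycle_conj c d a : #|T| = 9 ->
    has_cycle_type c [:: 9] -> has_cycle_type d [:: 9] -> c ^ d = c ^+ a ->
  exists2 w, w \in 'Alt_T & d = c ^ w.
Proof.
move=> T9 [cs [cyc full sz]] dt cda; have [us cg _] := has_cyclesP _ _ cyc.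
case: cs cyc full sz us cg => [|s [|]] //; rewrite [flatten _]cats0 /= => cyc full [szs] us cg.
have cs := cg s (mem_head _ _).
have [s0 s0s] : exists s0, s0 \in s by case: (s) szs => // s0 ? _; exists s0; rewrite mem_head.
pose t0 := nth s0 s 0; pose b := index (d t0) s.
have b9 : b < 9 by rewrite -szs index_mem full.
pose a' := a %% 9; have a9 : a' < 9 by rewrite ltn_mod.
(* In the coordinate [i] of the point [(c ^+ i) t0], [d] is the affine map with slope [a] and
   constant term [b]. *)
have dE i : i < 9 -> d (nth s0 s i) = nth s0 s (nth 0%N (affine9 a' b) i).
  move=> i9; have -> : nth s0 s i = (c ^+ i) t0.
    by rewrite (permX_cycle s0 i cs) ?szs // add0n modn_small.
  rewrite -permJ conjXg cda -expgM.
  have -> : d t0 = nth s0 s b by rewrite nth_index // full.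
  rewrite (permX_cycle s0 _ cs) ?szs // (nth_map 0%N) ?size_iota // nth_iota // add0n.
  by rewrite -[LHS]/(nth s0 s ((b + a * i) %% 9)) /a' -modnDmr -[in RHS]modnDmr modnMml.
pose w := affine9_orbit a' b.
have alt j : nth 0%N (affine9 a' b) j < 9.
  have [j9|j9] := ltnP j 9; last by rewrite nth_default // size_map size_iota.
  by rewrite (nth_map 0%N) ?size_iota // ltn_mod.
have wlt i : i < 9 -> nth 0%N w i < 9.
  by move=> i9; rewrite nth_traject //; case: i {i9} => // i; rewrite iterS.
have wE i : i < 9 -> nth s0 s (nth 0%N w i) = (d ^+ i) t0.
  move=> i9; rewrite nth_traject //; elim: i i9 => [|i IH] i9; first by rewrite expg0 perm1.
  rewrite expgSr permM -IH ?(ltnW i9) // dE ?iterS //.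
  by rewrite -(nth_traject (nth 0%N (affine9 a' b)) (ltnW i9)) wlt // ltnW.
have uw : uniq w.
  apply/(uniqP 0%N) => i j; rewrite !inE size_traject => i9 j9 /(congr1 (nth s0 s)).
  rewrite !wE //; wlog ij : i j i9 j9 / i <= j.
    by case/orP: (leq_total i j) => le W E; [|symmetry]; apply: W.
  rewrite -{1}(subnK ij) expgD permM => /perm_inj/esym/eqP.
  rewrite (nine_cycle_fix _ t0 dt) => /dvdn_leq; rewrite subn_gt0.
  case: ltngtP ij => // ij _ /(_ isT); rewrite leqNgt => /negP[].
  exact: leq_ltn_trans (leq_subr i j) j9.
have := allP affine9_check a'; rewrite mem_iota a9 => /(_ isT)/allP/(_ b).
rewrite mem_iota b9 => /(_ isT); cbv zeta; rewrite -/w uw.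
case/and5P=> /eqP pw w9 /allP wc uc /and3P[pos full9 oc].
pose t := map (nth s0 s) w.
have ut : uniq t.
  by rewrite map_inj_in_uniq // => i j /(allP w9) ? /(allP w9) ? /eqP; rewrite nth_uniq ?szs // => /eqP.
have ft : t =i predT.
  apply/subset_cardP; last by apply/subsetP.
  by rewrite (card_uniqP ut) size_map T9.
(* [v] is [i -> w_i], read on the points. *)
have [v vE] := perm_of_enumerations us ut full ft.
have fullz z : z \in map (nth s0 s) (flatten (list_cycles w)).
  apply/mapP; exists (index z s); last by rewrite nth_index // full.
  by rewrite (perm_mem full9) mem_iota -szs index_mem full.
exists v.
  rewrite Alt_even; have : has_cycle_type v (map size (list_cycles w)).
    exists (map (map (nth s0 s)) (list_cycles w)); split.
    - have lt9 i : i \in flatten (list_cycles w) -> i < 9.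
        by rewrite (perm_mem full9) mem_iota.
      apply/has_cyclesP; split.
      + rewrite -map_flatten map_inj_in_uniq // => i j /lt9 i9 /lt9 j9 /eqP.
        by rewrite nth_uniq ?szs // => /eqP.
      + move=> _ /mapP[e ecs ->]; rewrite -map_rot -(eqP (wc e ecs)) -!map_comp.
        apply/eq_in_map => i ie /=; have i9 : i < 9 by apply: lt9; apply/flattenP; exists e.
        by rewrite -(nth_map s0 s0 v) ?szs // vE (nth_map 0%N) // size_traject.
      + by move=> z; rewrite -map_flatten => /negP[]; apply: fullz.
    - by move=> z; rewrite -map_flatten; apply: fullz.
    - by rewrite -map_comp; apply: eq_map => e; rewrite /= size_map.
  by move/(odd_cycle_type pos) ->; rewrite T9 size_map oc.
apply: (@has_cycles_eq _ d (c ^ v) [:: t]).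
  have ftt : flatten [:: t] = t by rewrite -[LHS]/(t ++ [::]) cats0.
  apply/has_cyclesP; rewrite ftt; split=> //; last by move=> z; rewrite ft.
  move=> e; rewrite inE => /eqP ->; rewrite /t -map_rot -pw -!map_comp.
  by apply/eq_in_map => i /(allP w9) i9; apply: dE.
by rewrite -vE; apply: (has_cyclesJ v cyc).
Qed.

(* A Sylow 3-subgroup of [H] containing [c] and [d] is not one of [A_9], which contain 3-cycles,
   so it normalizes [<[c]>]; then [d] is an affine map of Z/9 when [c] is the translation by 1. *)
Lemma nine_cycles_conj H c d : #|T| = 9 -> H \subset 'Alt_T -> ~ has_prime_elt H 3 3 ->
    c \in H -> d \in H -> has_cycle_type c [:: 9] -> has_cycle_type d [:: 9] ->
  exists2 w, w \in 'Alt_T & d = c ^ w.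
Proof.
move=> T9 HA n3 ch dh ct dt.
have /card_gt0P[T0 _] : 0 < #|T| by rewrite T9.
have ord9 g : has_cycle_type g [:: 9] -> #[g] = 9.
  move=> gt; apply/eqP; rewrite eqn_dvd order_dvdn; apply/andP; split.
    by apply/eqP; apply: card_supp0; rewrite (card_supp_expg _ gt).
  by rewrite -(nine_cycle_fix _ T0 gt) expg_order perm1.
have p9 g : has_cycle_type g [:: 9] -> 3.-group <[g]>.
  by move=> gt; rewrite /pgroup -orderE ord9.
have [P sylP] := Sylow_exists 3 H.
have [pP PH] := (pHall_pgroup sylP, pHall_sub sylP).
have [|h1 h1H c1P] := Sylow_Jsub sylP _ (p9 c ct); first by rewrite cycle_subG.
have [|h2 h2H d2P] := Sylow_Jsub sylP _ (p9 d dt); first by rewrite cycle_subG.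
have c'P : c ^ h1 \in P.
  by apply: (subsetP c1P); rewrite memJ_conjg cycle_id.
have d'P : d ^ h2 \in P.
  by apply: (subsetP d2P); rewrite memJ_conjg cycle_id.
have [c't d't] := (has_cycle_typeJ h1 ct, has_cycle_typeJ h2 dt).
(* The exponent of 3 in 9!/2. *)
have l4 : logn 3 #|'Alt_T| = 4.
  have T1 : 1 < #|T| by rewrite T9.
  move: (card_Alt T1) => /(congr1 (logn 3)); rewrite lognM // ?cardG_gt0 // T9 logn_fact //.
  by rewrite /index_iota /= !big_cons big_nil.
have [k kE] := p_natP pP.
have k4 : k <= 4.
  by rewrite -l4 -(pfactorK k (isT : prime 3)) -kE dvdn_leq_log // cardSg // (subset_trans PH).
have ne4 : k != 4.
  apply/eqP => k4E; apply: n3.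
  have sylA : 3.-Sylow('Alt_T) P.
    by rewrite pHallE (subset_trans PH) //= p_part l4 kE k4E.
  have [z zt] : exists z : {perm T}, has_cycle_type z [:: 3; 1; 1; 1; 1; 1; 1]%N.
    by apply: exists_cycle_type; rewrite T9.
  have zA : z \in 'Alt_T by rewrite Alt_even (odd_cycle_type _ zt) // T9.
  have z3 : z ^+ 3 = 1 by apply: card_supp0; rewrite (card_supp_expg 3 zt).
  have p3 : 3.-group <[z]>.
    by rewrite /pgroup -orderE (pnat_dvd (_ : #[z] %| 3)) // order_dvdn z3.
  have [|w wA zP] := Sylow_Jsub sylA _ p3; first by rewrite cycle_subG.
  exists (z ^ w).
    by apply: (subsetP PH); apply: (subsetP zP); rewrite memJ_conjg cycle_id.
  by rewrite card_suppJ -conjXg z3 conj1g -[z]expg1 (card_supp_expg 1 zt).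
have nor : P \subset 'N(<[c ^ h1]>).
  have cP : <[c ^ h1]> \subset P by rewrite cycle_subG.
  have L := Lagrange cP; rewrite -orderE ord9 // kE in L.
  (* The order of [P] is now 9 or 27, and in a 3-group a subgroup of index 3 is normal. *)
  have [i3|i3] := eqVneq #|P : <[c ^ h1]>| 3.
    by apply: normal_norm; apply: (p_maximal_normal pP); apply: p_index_maximal; rewrite // i3.
  have i1 : #|P : <[c ^ h1]>| = 1%N.
    by move: k4 ne4 L i3; clear; case: k => [|[|[|[|[|]]]]] // _ _; rewrite ?expnS ?expn0;
       move: #|_ : _| => i; lia.
  have /eqP <- : <[c ^ h1]> == P by rewrite eqEsubset cP /= -indexg_eq1 i1.
  exact: normG.
have [a aE] : exists a, (c ^ h1) ^ (d ^ h2) = (c ^ h1) ^+ a.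
  apply/cycleP; rewrite -(normP (subsetP nor _ d'P)) memJ_conjg; exact: cycle_id.
have [w wA wE] := normalized_nine_cycle_conj T9 c't d't aE.
exists (h1 * w * h2^-1).
  by rewrite groupM ?groupV ?groupM //; apply: (subsetP HA).
by rewrite !conjgM -wE conjgK.
Qed.

End NineCycles.

(** * Degrees at least nine *)

Ltac split_sums H :=
  rewrite /= !inE in H;
  repeat match type of H with is_true (_ || _) => case/orP: H => H end;
  move/eqP in H.

Section NonCoverable.

Variables (T : finType) (n : nat).
Hypotheses (nE : #|T| = n) (n9 : 9 <= n).
Implicit Types (g h x y c d : {perm T}) (H K : {group {perm T}}) (lam mu : seq nat).

Lemma block_sums1 b mu : block_sums b 1 mu -> b \in map (addn 1) (subset_sums mu).
Proof.
by case=> r r1; rewrite (_ : r = 1)%N ?mul1n //; clear -r1; lia.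
Qed.

(** The fixed point lies in one block, so [b] is 1 or [n], against [3 <= b <= n/2]. *)
Lemma no_three_cycle_even H : ~~ odd n -> transitive_group H -> ~~ ('Alt_T \subset H) ->
  has_type H [:: 1; n - 1]%N -> ~ has_prime_elt H 3 3.
Proof.
move=> en tr nA ht h3; have [b [b3 _ b2 _ bs]] := three_cycle_block_size tr nA h3.
have [r r1] := bs 1%N _ isT ht; rewrite (_ : r = 1)%N; last by clear -r1; lia.
rewrite nE in b2 => bE; clear bs r1; split_sums bE; clear -n9 bE b2 b3; lia.
Qed.

(** One of the fixed points forces [b] to be 1, 2, [n - 1] or [n]. *)
Lemma no_three_cycle_odd H : odd n -> transitive_group H -> ~~ ('Alt_T \subset H) ->
  has_type H [:: 1; 1; n - 2]%N -> ~ has_prime_elt H 3 3.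
Proof.
move=> en tr nA ht h3; have [b [b3 _ b2 _ bs]] := three_cycle_block_size tr nA h3.
have [r r1] := bs 1%N _ isT ht; rewrite (_ : r = 1)%N; last by clear -r1; lia.
rewrite nE in b2 => bE; clear bs r1; split_sums bE; clear -n9 bE b2 b3; lia.
Qed.

Ltac arith := clear -nE n9; intros; rewrite /even_type ?nE /= ?inE; lia.

Lemma isolated3_prime_elt_cat H mu1 mu2 : all (fun l => ~~ (3 %| l)) (mu1 ++ mu2) ->
  has_type H (mu1 ++ 3 :: mu2) -> has_prime_elt H 3 3.
Proof.
move=> iso; pose m := foldr muln 1%N (mu1 ++ mu2).
have dv l : l \in mu1 ++ mu2 -> l %| m.
  rewrite /m; elim: (mu1 ++ mu2) => //= a s IH; rewrite inE => /predU1P[->|/IH].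
    exact: dvdn_mulr.
  exact: dvdn_mull.
have n3 : ~~ (3 %| m).
  rewrite /m; elim: (mu1 ++ mu2) iso => //= a s IH /andP[na /IH].
  by rewrite Euclid_dvdM // (negPf na).
have nil mu : {subset mu <= mu1 ++ mu2} -> [seq l <- mu | ~~ (l %| m)] = [::].
  move=> sub; rewrite -(filter_pred0 mu); apply/eq_in_filter => l /sub/dv ->.
  by [].
move/(@has_type_prime_elt T H _ m 3 3); apply.
  by rewrite filter_cat /= n3 !nil // => l lm; rewrite mem_cat lm ?orbT.
rewrite all_cat /= dvdn_mull //=; apply/andP.
by split; apply/allP => l lm; apply: dvdn_mulr; apply: dv; rewrite mem_cat lm ?orbT.
Qed.

(** If the other group has no 3-cycle, all these types fall to [K], as a power of each is a 3-cycle.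
    The 3 stands in the middle so that another part can come first, for use with [block_sums1]. *)
Definition has_three_types K := forall mu1 mu2, all (fun l => ~~ (3 %| l)) (mu1 ++ mu2) ->
  even_type T (mu1 ++ 3 :: mu2) -> has_type K (mu1 ++ 3 :: mu2).

(** If 3 does not divide [n], the type [3, n-3] leaves [b = 3], which does not divide [n]. Otherwise
    [n >= 12]: the type [3,1,1,n-5] leaves 3, 4, 5; read from a 1 it leaves 4, 5; then [3,2,2,n-7]
    leaves 5, and [3,1,4,n-8] leaves nothing. *)
Lemma three_types_even K : transitive_group K -> ~~ ('Alt_T \subset K) ->
  has_three_types K -> ~~ odd n -> False.
Proof.
move=> tr nA types en.
have h3 : has_prime_elt K 3 3.
  have [n3|n3] := boolP (3 %| n).
    apply: (@isolated3_prime_elt_cat K [::] [:: 1; 1; n - 5]%N); first by move: en n3; arith.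
    by apply: types; move: en n3; arith.
  apply: (@isolated3_prime_elt_cat K [::] [:: n - 3]%N); first by move: en n3; arith.
  by apply: types; move: en n3; arith.
have [b [b3 bn b2 b33 bs]] := three_cycle_block_size tr nA h3.
rewrite nE in b2 bn.
have [n3|n3] := boolP (3 %| n); last first.
  have bE : b \in map (addn 3) (subset_sums [:: n - 3]%N).
    by apply: b33; [|apply: (types [::])]; move: en n3; arith.
  split_sums bE; last by move: bE b2; arith.
  by move: bn; rewrite bE; move: n3; arith.
have b1 : b \in map (addn 3) (subset_sums [:: 1; 1; n - 5]%N).
  by apply: b33; [|apply: (types [::])]; move: en n3; arith.
have b1' : b \in map (addn 1) (subset_sums [:: 3; 1; n - 5]%N).
  apply: block_sums1; apply: bs => //.
  by apply: (types [:: 1%N] [:: 1%N; n - 5]%N); move: en n3; arith.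
have b2' : b \in map (addn 3) (subset_sums [:: 2; 2; n - 7]%N).
  by apply: b33; [|apply: (types [::])]; move: en n3; arith.
have b4 : b \in map (addn 3) (subset_sums [:: 1; 4; n - 8]%N).
  by apply: b33; [|apply: (types [::])]; move: en n3; arith.
split_sums b1; split_sums b2'; try (by move: b1 b2' b2 en n3 bn; arith).
all: split_sums b1'; try (by move: b1 b2' b1' b2 en n3; arith).
all: split_sums b4; try (by move: b1 b2' b1' b4 b2 en n3; arith).
Qed.

(** For [n] congruent to 1 modulo 3, the type [3,5,n-8] leaves [b = 3] or 8, which do not divide
    [n]. Otherwise [3,1,n-4], read from the 3 and from the 1, leaves [b = 4], but [n] is odd. *)
Lemma three_types_odd K : transitive_group K -> ~~ ('Alt_T \subset K) ->
  has_three_types K -> odd n -> False.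
Proof.
move=> tr nA types on.
have h3 : has_prime_elt K 3 3.
  have [n1|n1] := eqVneq (n %% 3) 1%N.
    apply: (@isolated3_prime_elt_cat K [::] [:: 5; n - 8]%N); first by move: on n1; arith.
    by apply: types; move: on n1; arith.
  apply: (@isolated3_prime_elt_cat K [::] [:: 1; n - 4]%N); first by move: on n1; arith.
  by apply: types; move: on n1; arith.
have [b [b3 bn b2 b33 bs]] := three_cycle_block_size tr nA h3.
rewrite nE in b2 bn.
have [n1|n1] := eqVneq (n %% 3) 1%N.
  have bE : b \in map (addn 3) (subset_sums [:: 5; n - 8]%N).
    by apply: b33; [|apply: (types [::])]; move: on n1; arith.
  by split_sums bE; rewrite bE in bn; move: bn n1 bE on b2; arith.
have bE : b \in map (addn 3) (subset_sums [:: 1; n - 4]%N).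
  by apply: b33; [|apply: (types [::])]; move: on n1; arith.
have b1' : b \in map (addn 1) (subset_sums [:: 3; n - 4]%N).
  apply: block_sums1; apply: bs => //.
  by apply: (types [:: 1%N] [:: n - 4]%N); move: on n1; arith.
by split_sums bE; split_sums b1'; rewrite bE in bn; move: bn n1 bE b1' on b2; arith.
Qed.

(** The group that contains the type with one fixed point, or two in odd degree, has no 3-cycle. All
    types with an isolated 3 must then lie in the other group, where their block sizes are
    contradictory. *)
Lemma both_transitive H K :
    (forall x, x \in 'Alt_T -> exists2 g, g \in 'Alt_T & x ^ g \in H \/ x ^ g \in K) ->
    ~~ ('Alt_T \subset H) -> ~~ ('Alt_T \subset K) ->
    transitive_group H -> transitive_group K -> False.
Proof.
move=> cov nH nK.
wlog ht : H K cov nH nK /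
    has_type H (if odd n then [:: 1; 1; n - 2] else [:: 1; n - 1])%N.
  move=> W tH tK; have [||hH|hK] := @even_type_cover T H K
      (if odd n then [:: 1; 1; n - 2] else [:: 1; n - 1])%N => //.
  - by case: ifP; arith.
  - exact: (W H K).
  - apply: (W K H) => // x /cov[g gA []]; exists g => //; [by right|by left].
move=> tH tK.
have h3 : ~ has_prime_elt H 3 3.
  by case: ifP ht => on; [apply: no_three_cycle_odd|apply: no_three_cycle_even]; rewrite ?on.
have types : has_three_types K.
  move=> mu1 mu2 iso ev; have [|//] := even_type_cover cov ev.
  by move/(isolated3_prime_elt_cat iso).
by have [on|on] := boolP (odd n); [exact: (three_types_odd tK nK types on)|exact: (three_types_even tK nK types on)].
Qed.

(** The square of the element of type [2, l] fixes just two points. Conjugated so that these become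
    two of the fixed points of the other element, it moves the third. *)
Lemma three_transitive H l l' : ktransitive H 2 -> ~~ (l %| 2) -> has_type H [:: 2; l] ->
  has_type H [:: 1; 1; 1; l']%N -> ktransitive H 3.
Proof.
move=> tr l2 [u uh [cs [cyc full sz]]] [g gh gt].
have [s [us szs fs tc]] := @cycle_type_fixed_points _ g 3 l' gt.
case: s us szs fs tc => [|p1 [|p2 [|p3 []]]] // us _ fs tc.
have [ucs cg _] := has_cyclesP _ _ cyc.
case: cs cyc full sz ucs cg => [|[|a [|b [|e c0]]] [|c [|d cs]]] // cyc full [szc] ucs cg.
have /= [ua ub] := cg [:: a; b] (mem_head _ _).
have ab : a != b by move: ucs; rewrite /= inE negb_or => /andP[/andP[]].
have [||||h hh [ha hb]] := tr [:: a; b] [:: p1; p2] => //.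
- by rewrite /= inE ab.
- by move: us; rewrite /= !inE !negb_or => /andP[/andP[->]].
have mv z : z \notin [:: a; b] -> (u ^+ 2) z != z.
  move=> nz; have zc : z \in c.
    by move: (full z); rewrite -[flatten _]/([:: a; b] ++ (c ++ [::])) cats0 mem_cat (negPf nz).
  have uc : uniq c by apply: (uniq_flatten_mem ucs); rewrite !inE eqxx orbT.
  by rewrite (permX_cycle_fix 2 (cg c _)) ?szc // !inE eqxx orbT.
have us' : uniq [:: p3; p1; p2] by rewrite -(rot_uniq 1).
apply: (@ktransitive_extend_moved T H 2 ((u ^+ 2) ^ h) [:: p1; p2] p3 g) => //.
- by rewrite groupJ ?groupX.
- by move=> y yp; apply: fs; move: yp; rewrite !inE => /orP[]->; rewrite ?orbT.
- have u2 z : z \in [:: a; b] -> (u ^+ 2) z = z.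
    by rewrite !inE => /orP[]/eqP->; rewrite expgS expg1 permM ?ua ?ub ?ua.
  move=> y; rewrite -ha -hb !inE => /orP[]/eqP->; rewrite permJ u2 // !inE eqxx ?orbT //.
- rewrite -{1 2}[p3](permKV h) permJ (inj_eq perm_inj) mv //.
  have : p3 \notin [:: p1; p2] by case/andP: us'.
  apply: contra; rewrite -ha -hb !inE.
  by case/orP=> /eqP <-; rewrite permKV eqxx ?orbT.
- move=> y z ny nz; apply: tc; [move: ny|move: nz]; rewrite !inE !negb_or.
  all: by case/and3P=> -> -> ->.
Qed.

(** * A transitive group with all even types that avoid the partial sum k *)

Section Intransitive.

Variables (H : {group {perm T}}) (k : nat).
Hypotheses (tr : transitive_group H) (nA : ~~ ('Alt_T \subset H)) (k0 : 0 < k) (k2 : k.*2 <= n).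
Hypothesis (types : forall lam, even_type T lam -> k \notin subset_sums lam -> has_type H lam).

(** For [k = 1] and [k = 2] the type [1,1,n-2] may be missing, and block sizes decide. From [k = 3]
    on it is present together with the full cycle, so [H] is 2-transitive without 3-cycles, and it
    suffices to find one type with a power of small support. *)
Lemma intransitive_odd : odd n -> k = 4 /\ n = 9.
Proof.
move=> on.
have [k1|k1] := eqVneq k 1%N.
  exfalso; have h3 : has_prime_elt H 3 3.
    have [n2|n2] := eqVneq (n %% 3) 2.
      apply: (@isolated3_prime_elt_cat H [::] [:: 4; n - 7]%N).
        by move: on n2; arith.
      by apply: types; move: on n2 k1; arith.
    apply: (@isolated3_prime_elt_cat H [::] [:: 2; n - 5]%N).
      by move: on n2; arith.
    by apply: types; move: on n2 k1; arith.
  have [b [b3 bn b2 _ bs]] := three_cycle_block_size tr nA h3.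
  rewrite nE in b2 bn; have ob := dvdn_odd bn on.
  (* A 2-cycle meets [r <= 2] classes, so [r b] is 2, 4, [n - 2] or [n]; an odd [b] between 3 and
     [n/2] fits none of these. *)
  have [|r r2 rE] := bs 2 [:: 2; n - 4]%N isT; first by apply: types; move: on k1; arith.
  have [rr|rr] : r = 1%N \/ r = 2 by move: r2; clear; lia.
    by rewrite rr mul1n in rE; split_sums rE; move: rE ob b3 b2 on; arith.
  by rewrite rr in rE; split_sums rE; move: rE ob b3 b2 on; arith.
have [k2'|k2'] := eqVneq k 2.
  exfalso; have [n1|n1] := eqVneq (n %% 3) 1%N.
    have t : has_type H [:: 3; 5; n - 8]%N by apply: types; move: on n1 k2'; arith.
    have h3 : has_prime_elt H 3 3.
      by apply: (@isolated3_prime_elt_cat H [::] [:: 5; n - 8]%N) => //; move: on n1; arith.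
    have [b [b3 bn b2 b33 _]] := three_cycle_block_size tr nA h3.
    rewrite nE in b2 bn.
    have bE : b \in map (addn 3) (subset_sums [:: 5; n - 8]%N).
      by apply: b33 => //; move: on n1; arith.
    by split_sums bE; rewrite bE in bn; move: bn n1 bE on b2; arith.
  have t : has_type H [:: 3; 1; n - 4]%N by apply: types; move: on n1 k2'; arith.
  have h3 : has_prime_elt H 3 3.
    by apply: (@isolated3_prime_elt_cat H [::] [:: 1; n - 4]%N) => //; move: on n1; arith.
  have [b [b3 bn b2 b33 bs]] := three_cycle_block_size tr nA h3.
  rewrite nE in b2 bn; have ob := dvdn_odd bn on.
  have bE : b \in map (addn 3) (subset_sums [:: 1; n - 4]%N).
    by apply: b33 => //; move: on n1; arith.
  have b1' : b \in map (addn 1) (subset_sums [:: 3; n - 4]%N).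
    by apply: block_sums1; apply: bs => //; apply: types; move: on n1 k2'; arith.
  by split_sums bE; split_sums b1'; move: ob n1 bE b1' on b2; arith.
have t1 : has_type H [:: 1; 1; n - 2]%N by apply: types; move: on k0 k2 k1 k2'; arith.
have tn : has_type H [:: #|T|] by rewrite nE; apply: types; move: on k0 k2; arith.
have n3 := no_three_cycle_odd on tr nA t1.
have tt : two_transitive H.
  by apply: ktransitive_two; apply: (odd_two_transitive _ _ tn t1); move: on; arith.
have n5 : ~ has_prime_elt H 5 5.
  by move/(two_transitive_five_cycle tt _); apply: contra_not n3; apply; move: n9; arith.
have n4 : ~ has_prime_elt H 2 4.
  by move/(two_transitive_double_transp tt _); apply: contra_not n3; apply; move: n9; arith.
have k4 : k = 4.
  apply/eqP; apply: contraT => k4; exfalso; apply: n4.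
  apply: (@two_two_prime_elt _ H [:: n - 4]%N); first by move: on; arith.
  by apply: types; move: on k0 k2 k1 k2' k4; arith.
split=> //; apply/eqP; apply: contraT => nn9; exfalso.
(* The type [3,7,n-10] used below has the partial sum 4 in degree 11, just as [3,5,n-8] has in
   degree 9. In degree 11 the ninth power of [5,3,3] is a 5-cycle instead. *)
have [n11|n11] := eqVneq n 11.
  apply: n5; apply: (@has_type_prime_elt _ H [:: 5; 3; 3] 9) => //.
  by apply: types; move: n11 k4; arith.
apply: n3.
have [n1|n1] := eqVneq (n %% 3) 1%N.
  apply: (@isolated3_prime_elt_cat H [::] [:: 2; n - 5]%N); first by move: on n1; arith.
  by apply: types; move: on n1 k4; arith.
have [n2|n2] := eqVneq (n %% 3) 2.
  apply: (@isolated3_prime_elt_cat H [::] [:: 7; n - 10]%N); first by move: on n2; arith.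
  by apply: types; move: on n2 k4 n11; arith.
apply: (@isolated3_prime_elt_cat H [::] [:: 5; n - 8]%N); first by move: on n1 n2; arith.
by apply: types; move: on n2 n1 k4 nn9; arith.
Qed.

Lemma intransitive_even : ~~ odd n -> False.
Proof.
move=> en.
have [k1|k1] := eqVneq k 1%N.
  have [n3|n3] := boolP (3 %| n); last first.
    have t : has_type H [:: 3; n - 3]%N by apply: types; move: en n3 k1; arith.
    have h3 : has_prime_elt H 3 3.
      by apply: (@isolated3_prime_elt_cat H [::] [:: n - 3]%N) => //; move: en n3; arith.
    have [b [b3 bn b2 b33 _]] := three_cycle_block_size tr nA h3.
    rewrite nE in b2 bn.
    have bE : b \in map (addn 3) (subset_sums [:: n - 3]%N).
      by apply: b33 => //; move: en n3; arith.
    by split_sums bE; rewrite bE in bn; move: bn n3 bE en b2; arith.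
  (* Here 6 divides [n]. This type leaves [b] among 3, 5, 7; read from a 2-cycle it refutes 3, and
     the other two values are refuted by further types. *)
  have t : has_type H [:: 3; 2; 2; n - 7]%N by apply: types; move: en n3 k1; arith.
  have h3 : has_prime_elt H 3 3.
    by apply: (@isolated3_prime_elt_cat H [::] [:: 2; 2; n - 7]%N) => //; move: en n3; arith.
  have [b [b3 bn b2 b33 bs]] := three_cycle_block_size tr nA h3.
  rewrite nE in b2 bn.
  have bE : b \in map (addn 3) (subset_sums [:: 2; 2; n - 7]%N).
    by apply: b33 => //; move: en n3; arith.
  have b5 : b \in map (addn 3) (subset_sums [:: 2; 5; n - 10]%N).
    apply: b33; first by move: en n3; arith.
    by apply: types; move: en n3 k1; arith.
  have [|r r2 rE] := bs 2 [:: 3; 2; n - 7]%N isT; first by apply: types; move: en n3 k1; arith.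
  have b357 : b = 3 \/ b = 5 \/ b = 7.
    by split_sums bE; move: bE b2 en n3; arith.
  case: b357 => [b3E|[b5E|b7E]].
  - have [rr|rr] : r = 1%N \/ r = 2 by move: r2; clear; lia.
      by rewrite rr mul1n in rE; split_sums rE; move: rE b3E en n3; arith.
    by rewrite rr in rE; split_sums rE; move: rE b3E en n3; arith.
  - have n18 : 18 <= n by rewrite b5E in bn; move: bn n3 en; arith.
    have b4 : b \in map (addn 3) (subset_sums [:: 4; 4; n - 11]%N).
      apply: b33; first by move: en n3; arith.
      by apply: types; move: en n3 k1 n18; arith.
    by split_sums b4; move: b4 b5E b2 n18 en; arith.
  - have n42 : 42 <= n by rewrite b7E in bn; move: bn n3 en; arith.
    by split_sums b5; move: b5 b7E b2 n42 en; arith.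
have t1 : has_type H [:: 1; n - 1]%N by apply: types; move: en k0 k2 k1; arith.
have n3' := no_three_cycle_even en tr nA t1.
have tt2 : ktransitive H 2.
  apply: (@fixed_points_ktransitive T H 1 (n - 1) _ (transitive_ktransitive tr) t1).
  by arith.
have tt := ktransitive_two tt2.
have n5 : ~ has_prime_elt H 5 5.
  by move/(two_transitive_five_cycle tt _); apply: contra_not n3'; apply; move: n9; arith.
have n4 : ~ has_prime_elt H 2 4.
  by move/(two_transitive_double_transp tt _); apply: contra_not n3'; apply; move: n9; arith.
have [n3|n3] := boolP (3 %| n); last first.
  have k3 : k = 3.
    apply/eqP; apply: contraT => k3; exfalso; apply: n3'.
    apply: (@isolated3_prime_elt_cat H [::] [:: n - 3]%N); first by move: en n3; arith.
    by apply: types; move: en n3 k0 k2 k1 k3; arith.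
  (* In degree 10 the type [2,2,5,n-9] would have the partial sum 3; there the sixth power of [4,6]
     is a double transposition. *)
  apply: n4; have [n10|n10] := eqVneq n 10.
    apply: (@has_type_prime_elt _ H [:: 4; 6] 6) => //.
    by apply: types; move: n10 k3; arith.
  apply: (@two_two_prime_elt _ H [:: 5; n - 9]%N); first by move: en; arith.
  by apply: types; move: en n3 k3 n10; arith.
have [k2'|k2'] := eqVneq k 2.
  apply: n3'; apply: (@isolated3_prime_elt_cat H [::] [:: 1; 4; n - 8]%N).
    by move: en n3; arith.
  by apply: types; move: en n3 k2'; arith.
(* In degree 12 the types used here for [k] = 3, 4, 5 either have the partial sum [k] or fail to be
   types of that degree. *)
have [n12|n12] := eqVneq n 12; last first.
  have n18 : 18 <= n by move: en n3 n12; arith.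
  have k45 : k = 4 \/ k = 5.
    have [k5|k5] := boolP ((k == 4) || (k == 5)); first by move: k5; arith.
    exfalso; apply: n4; have [k3|k3] := eqVneq k 3.
      apply: (@two_two_prime_elt _ H [:: 5; n - 9]%N); first by move: en n18; arith.
      by apply: types; move: en n3 k3 n18; arith.
    apply: (@two_two_prime_elt _ H [:: 1; n - 5]%N); first by move: en n18; arith.
    by apply: types; move: en k0 k2 k1 k2' k3 k5 n18; arith.
  apply: n3'; case: k45 => k45.
    apply: (@isolated3_prime_elt_cat H [::] [:: 2; 5; n - 10]%N).
      by move: en n3; arith.
    by apply: types; move: en n3 k45 n18; arith.
  apply: (@isolated3_prime_elt_cat H [::] [:: 4; 7; n - 14]%N).
    by move: en n3 n18; arith.
  by apply: types; move: en n3 k45 n18; arith.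
have [k3|k3] := eqVneq k 3.
  apply: n4; apply: (@has_type_prime_elt _ H [:: 4; 1; 1; 6]%N 6) => //.
  by apply: types; move: n12 k3; arith.
have [k6|k6] := eqVneq k 6.
  apply: n4; apply: (@two_two_prime_elt _ H [:: 1; 7]%N) => //.
  by apply: types; move: n12 k6; arith.
have [k4|k4] := eqVneq k 4.
  apply: n5; apply: (@has_type_prime_elt _ H [:: 5; 7] 7) => //.
  by apply: types; move: n12 k4; arith.
have k5 : k = 5 by move: k0 k2 k1 k2' k3 k4 k6 n12; arith.
(* Here the square of [2,2,2,6], a product of two 3-cycles, is used; this requires
   4-transitivity. *)
have t2 : has_type H [:: 2; 10] by apply: types; move: n12 k5; arith.
have t3 : has_type H [:: 1; 1; 1; 9]%N by apply: types; move: n12 k5; arith.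
have tt3 := three_transitive tt2 (isT : ~~ (10 %| 2)) t2 t3.
have tt4 : ktransitive H 4.
  by apply: (@fixed_points_ktransitive T H 3 9 _ tt3 t3); move: n12; arith.
have h6 : has_prime_elt H 3 6.
  apply: (@has_type_prime_elt _ H [:: 2; 2; 2; 6] 2) => //.
  by apply: types; move: n12 k5; arith.
by case: (four_transitive_two_three_cycles tt4 h6).
Qed.

End Intransitive.

(** Since 4 is not a partial sum of the single part 9, every 9-cycle has an A_9-conjugate in [H].
    For a 9-cycle [c] and its conjugate by a transposition this yields an odd permutation
    centralizing [c]. But only the powers of [c] centralize it, and they are even. *)
Lemma nine_not_covered H K : n = 9 -> H \subset 'Alt_T -> ~~ ('Alt_T \subset H) ->
    transitive_group H ->
    (forall lam, even_type T lam -> 4 \notin subset_sums lam -> has_type H lam) ->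
    (forall lam, has_type K lam -> 4 \in subset_sums lam) ->
    (forall x, x \in 'Alt_T -> exists2 g, g \in 'Alt_T & x ^ g \in H \/ x ^ g \in K) ->
  False.
Proof.
move=> N9 HA nA tr types K4 cov.
have T9 : #|T| = 9 by rewrite nE.
have t1 : has_type H [:: 1; 1; n - 2]%N by apply: types; move: N9; arith.
have on : odd n by rewrite N9.
have n3 := no_three_cycle_odd on tr nA t1.
have [c ct] : exists c : {perm T}, has_cycle_type c [:: 9].
  by apply: exists_cycle_type; rewrite T9.
have inH y : has_cycle_type y [:: 9] -> exists2 g, g \in 'Alt_T & y ^ g \in H.
  move=> yt; have yA : y \in 'Alt_T by rewrite Alt_even (odd_cycle_type _ yt) // T9.
  have [g gA [gH|gK]] := cov y yA; first by exists g.
  have : has_type K [:: 9] by exists (y ^ g) => //; apply: has_cycle_typeJ.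
  by move/K4.
have [z0 [z1 z01]] : exists z0 z1 : T, z0 != z1.
  have /card_gt1P[z0 [z1 [_ _ z01]]] : 1 < #|T| by rewrite T9.
  by exists z0, z1.
pose t := tperm z0 z1.
have [g gA cg] := inH c ct; have [h hA dh] := inH (c ^ t) (has_cycle_typeJ t ct).
have [w wA wE] := nine_cycles_conj T9 HA n3 cg dh (has_cycle_typeJ g ct)
                    (has_cycle_typeJ h (has_cycle_typeJ t ct)).
pose s := t * (g * w * h^-1)^-1.
have os : odd_perm s.
  have : g * w * h^-1 \in 'Alt_T by rewrite !groupM ?groupV.
  by rewrite Alt_even => /negPf E; rewrite /s odd_permM odd_permV E odd_tperm z01.
have cs : c ^ s = c.
  rewrite conjgM; apply: (canLR (conjgK _)).
  by rewrite !conjgM -wE !conjgK.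
(* [s] agrees with a power of [c] at one point, and both commute with [c], which is transitive. *)
have [m mE] : exists m, s = c ^+ m.
  have [cs' [cyc full sz]] := ct; have [us cc _] := has_cyclesP _ _ cyc.
  case: cs' full sz us cc {cyc} => [|s0 [|]] //; rewrite [flatten _]cats0 => full [szs] us cc.
  have cc0 := cc s0 (mem_head _ _).
  have [m mE] := cycle_trans cc0 (eq_ind_r is_true isT (full z0)) (eq_ind_r is_true isT (full (s z0))).
  exists m; apply/permP => z.
  have [j <-] := cycle_trans cc0 (eq_ind_r is_true isT (full z0)) (eq_ind_r is_true isT (full z)).
  by rewrite -permJ conjXg cs -mE -!permM -!expgD addnC.
move: os; rewrite mE.
have : c ^+ m \in 'Alt_T by rewrite groupX // Alt_even (odd_cycle_type _ ct) // T9.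
by rewrite Alt_even => /negPf ->.
Qed.

Lemma not_covered H K : H \subset 'Alt_T -> K \subset 'Alt_T ->
    ~~ ('Alt_T \subset H) -> ~~ ('Alt_T \subset K) ->
    (forall x, x \in 'Alt_T -> exists2 g, g \in 'Alt_T & x ^ g \in H \/ x ^ g \in K) ->
  False.
Proof.
wlog: H K / transitive_group H.
  move=> W HA KA nH nK cov.
  have [tH|[kH [kH0 kH2 sH]]] := transitive_or_sums H; first exact: (W H K).
  have [tK|[kK [kK0 kK2 sK]]] := transitive_or_sums K.
    by apply: (W K H) => // x /cov[g gA []]; exists g => //; [right|left].
  rewrite nE in kH2 kK2.
  (* Neither group is transitive here. A full cycle has no proper partial sum, and for even [n] the
     types [1,n-1], [2,n-2], [3,n-3] would need three values among the two numbers [kH], [kK]. *)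
  have [on|en] := boolP (odd n).
    have [] := @even_type_cover T H K [:: n] cov; first by move: on; arith.
      by move/sH => E; split_sums E; move: E kH0 kH2; arith.
    by move/sK => E; split_sums E; move: E kK0 kK2; arith.
  have k a : 1 <= a <= 3 -> kH = a \/ kK = a.
    move=> a13; have [] := @even_type_cover T H K [:: a; n - a]%N cov.
    - by move: en a13; arith.
    - by move/sH => E; left; split_sums E; move: E kH0 kH2 a13; arith.
    - by move/sK => E; right; split_sums E; move: E kK0 kK2 a13; arith.
  have := k 1%N isT; have := k 2 isT; have := k 3 isT; clear; lia.
move=> tH HA KA nH nK cov.
have [tK|[k [k0 k2 sK]]] := transitive_or_sums K.
  exact: (both_transitive cov nH nK tH tK).
rewrite nE in k2.
have types lam : even_type T lam -> k \notin subset_sums lam -> has_type H lam.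
  move=> ev nk; have [//|/sK] := even_type_cover cov ev.
  by rewrite (negPf nk).
have [on|en] := boolP (odd n); last exact: (intransitive_even tH nH k0 k2 types en).
have [k4 N9] := intransitive_odd tH nH k0 k2 types on; rewrite k4 in types sK.
exact: (nine_not_covered N9 HA nH tH types sK cov).
Qed.

End NonCoverable.

(** * Coverings in degrees four to eight *)

Section Coverings.

Variable gT : finGroupType.
Implicit Types (G H K : {group gT}).

(* Counting non-identity elements: the conjugates of [K] contain at most
   [#|G : K| * (#|K| - 1) = #|G| - #|G : K|] of them. *)
Lemma conjugates_do_not_cover G K : K \proper G ->
  exists2 x, x \in G & forall g, g \in G -> x ^ g \notin K.
Proof.
move=> pKG; have sKG := proper_sub pKG.
have [/exists_inP[x xG /forall_inP nx]|] :=
    boolP [exists x in G, [forall g in G, x ^ g \notin K]]; first by exists x.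
rewrite negb_exists_in => /forall_inP cov; exfalso.
have sG : G^# \subset (class_support K G)^#.
  apply/subsetP => x /setD1P[x1 xG]; rewrite !inE x1 /=.
  have := cov x xG; rewrite negb_forall_in => /exists_inP[g gG]; rewrite negbK => xgK.
  by rewrite -[x](conjgK g) memJ_class_support ?groupV.
move: (subset_leq_card sG); rewrite class_supportD1 => le.
have le2 := leq_trans le (leq_card_cover _).
have cst : (\sum_(A in K^# :^: G) #|A| = #|K^# :^: G| * #|K|.-1)%N.
  rewrite -sum_nat_const; apply: eq_bigr => A /imsetP[g _ ->].
  by rewrite cardJg (cardsD1 1 K) group1.
have conj : #|K^# :^: G| <= #|G : K|.
  rewrite card_conjugates; apply: dvdn_leq; rewrite ?indexg_gt0 //.
  apply: indexgS; rewrite subsetI sKG /=.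
  by rewrite normD1 normG.
rewrite cst in le2; have L := Lagrange sKG.
have i1 : 1 < #|G : K| by rewrite indexg_gt1 proper_subn.
have := leq_trans le2 (leq_mul conj (leqnn _)).
move: (cardsD1 1 G) L i1 (cardG_gt0 K); rewrite group1.
by move: #|G^#| #|G| #|K| #|G : K| => a b c i; nia.
Qed.

(** Nested members are automatically equal: conjugates of one subgroup have the same order, and if a
    conjugate of [H] lay in one of [K], the conjugates of [K] alone would cover [G]; likewise with
    [H] and [K] exchanged. *)
Lemma star_star_coverableP G : star_star_coverable G <->
  exists H K, [/\ H \proper G, K \proper G
    & forall x, x \in G -> exists2 g, g \in G & x ^ g \in H \/ x ^ g \in K].
Proof.
split=> -[H [K [pH pK cov]]]; exists H, K; split=> //.
  case: cov => _ U _ x; rewrite -{1}U => /bigcupP[M].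
  rewrite inE => /orP[] /imsetP[g gG ->] xM; exists g^-1; rewrite ?groupV //.
    by left; rewrite -mem_conjg.
  by right; rewrite -mem_conjg.
have mem M : M \in conjugate_subgroups G H :|: conjugate_subgroups G K ->
    exists2 g, g \in G & M = (H :^ g)%G \/ M = (K :^ g)%G.
  by rewrite inE => /orP[] /imsetP[g gG ->]; exists g => //; [left|right].
have no (A B : {group gT}) g h : g \in G -> h \in G -> B \proper G ->
   (forall x, x \in G -> exists2 k, k \in G & x ^ k \in A \/ x ^ k \in B) ->
   A :^ g \subset B :^ h -> False.
  move=> gG hG pB cv sub; have [x xG nx] := conjugates_do_not_cover pB.
  have [k kG [kA|kB]] := cv x xG; last by move: (nx k kG); rewrite kB.
  have : x ^ (k * g * h^-1) \in B.
    by rewrite conjgM -mem_conjg (subsetP sub) // conjgM memJ_conjg.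
  by apply/negP/nx; rewrite !groupM ?groupV.
split.
- move=> M /mem[g gG [] ->] /=.
    by rewrite -(conjGid gG) properJ.
  by rewrite -(conjGid gG) properJ.
- apply/eqP; rewrite eqEsubset; apply/andP; split.
    apply/bigcupsP => M /mem[g gG [] ->] /=; rewrite -(conjGid gG) conjSg proper_sub //.
  apply/subsetP => x xG; have [g gG [xH|xK]] := cov x xG; apply/bigcupP.
    exists (H :^ g^-1)%G; last by rewrite mem_conjg invgK.
    by rewrite inE; apply/orP; left; apply/imsetP; exists g^-1; rewrite ?groupV.
  exists (K :^ g^-1)%G; last by rewrite mem_conjg invgK.
  by rewrite inE; apply/orP; right; apply/imsetP; exists g^-1; rewrite ?groupV.
- have swap : forall x, x \in G -> exists2 k, k \in G & x ^ k \in K \/ x ^ k \in H.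
    by move=> x /cov[k kG []]; exists k => //; [right|left].
  have same (A : {group gT}) g h : A :^ g \subset A :^ h -> (A :^ g)%G = (A :^ h)%G :> {group gT}.
    by move=> sub; apply/val_inj/eqP; rewrite /= eqEcard sub !cardJg leqnn.
  move=> M N /mem[g gG [] ->] /mem[h hG [] ->] sub; try exact: same.
    by case: (no H K g h).
  by case: (no K H g h).
Qed.

End Coverings.

Section CycleDecomposition.

Variable T : finType.
Implicit Types (g h : {perm T}) (a z : T).

Lemma cycle_decomposition g : exists cs,
  [/\ has_cycles g cs, flatten cs =i predT & all (leq 1) (map size cs)].
Proof.
suff [cs [u cg pos sub]] : exists cs, [/\ uniq (flatten cs),
    {in cs, forall c, map g c = rot 1 c}, all (leq 1) (map size cs)
    & {subset enum T <= flatten cs}].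
  have full : flatten cs =i predT by move=> z; rewrite sub ?mem_enum.
  by exists cs; split=> //; apply/has_cyclesP; split=> // z; rewrite full.
elim: (enum T) => [|a s [cs [u cg pos sub]]]; first by exists [::].
have [acs|acs] := boolP (a \in flatten cs).
  by exists cs; split=> // z; rewrite inE => /predU1P[->|/sub].
pose c := traject g a #|porbit g a|.
have cc : map g c = rot 1 c by apply: map_traject_rot; apply: iter_porbit.
have ac : a \in c by rewrite -porbit_traject porbit_id.
exists (c :: cs); split=> /=.
- rewrite cat_uniq uniq_traject_porbit u andbT; apply/hasPn => z /flattenP[d dcs zd].
  apply: contra acs => zc; have [m <-] := cycle_trans cc zc ac.
  by apply/flattenP; exists d => //; apply: permX_cycle_mem (cg d dcs) zd.
- by move=> d; rewrite inE => /predU1P[->|/cg].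
- by rewrite pos andbT; case: (c) ac.
- by move=> z; rewrite inE mem_cat => /predU1P[->|/sub ->]; rewrite ?ac ?orbT.
Qed.

End CycleDecomposition.

(** * Subgroups of alternating groups defined by an invariant relation *)

Section RelationGroups.

Variables (m : nat) (R : nat -> nat -> nat -> nat -> bool).
Local Notation n := m.+1.

(** Four arguments serve all the groups at once: affine maps preserve the relation between the
    vertices of a parallelogram, and sets and partitions need only one or two of the arguments. *)
Definition preserving : {set {perm 'I_n}} :=
  [set g in 'Alt_('I_n) |
    [forall x : 'I_n, forall y : 'I_n, forall z : 'I_n, forall w : 'I_n, R x y z w == R (g x) (g y) (g z) (g w)]].

Lemma preservingP g : reflect
  (g \in 'Alt_('I_n) /\ forall x y z w : 'I_n, R x y z w = R (g x) (g y) (g z) (g w))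
  (g \in preserving).
Proof.
have -> : (g \in preserving) = (g \in 'Alt_('I_n)) && [forall x : 'I_n, forall y : 'I_n,
    forall z : 'I_n, forall w : 'I_n, R x y z w == R (g x) (g y) (g z) (g w)].
  by rewrite [LHS]in_set.
apply: (iffP andP) => -[gA pr]; split=> //.
  move=> x y z w; apply/eqP.
  by move/forallP/(_ x)/forallP/(_ y)/forallP/(_ z)/forallP/(_ w): pr.
by do 4!apply/forallP=> ?; apply/eqP.
Qed.

Lemma preserving_group_set : group_set preserving.
Proof.
apply/group_setP; split.
  by apply/preservingP; split=> [|x y z w]; rewrite ?group1 ?perm1.
move=> g h /preservingP[gA gR] /preservingP[hA hR]; apply/preservingP.
by split=> [|x y z w]; rewrite ?groupM // !permM -hR.
Qed.

Canonical preserving_group := Group preserving_group_set.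

Definition list_preserves (p : seq nat) : bool :=
  all (fun x => all (fun y => all (fun z => all (fun w =>
    R x y z w == R (nth 0 p x) (nth 0 p y) (nth 0 p z) (nth 0 p w))%N
    (iota 0 n)) (iota 0 n)) (iota 0 n)) (iota 0 n).

Lemma list_preservesP g p : g \in 'Alt_('I_n) -> (forall x, val (g x) = nth 0%N p x) ->
  list_preserves p = (g \in preserving).
Proof.
move=> gA gE; have io (x : 'I_n) : val x \in iota 0 n by rewrite mem_iota /= add0n ltn_ord.
apply/idP/preservingP => [pr|[_ pr]].
  split=> // x y z w; rewrite !gE; apply/eqP.
  by move/allP/(_ _ (io x))/allP/(_ _ (io y))/allP/(_ _ (io z))/allP/(_ _ (io w)): pr.
have oi i : i \in iota 0 n -> i < n by rewrite mem_iota.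
apply/allP => x /oi xn; apply/allP => y /oi yn; apply/allP => z /oi zn; apply/allP => w /oi wn.
rewrite -(gE (Ordinal xn)) -(gE (Ordinal yn)) -(gE (Ordinal zn)) -(gE (Ordinal wn)).
by apply/eqP; exact: (pr (Ordinal xn) (Ordinal yn) (Ordinal zn) (Ordinal wn)).
Qed.

End RelationGroups.

Section Criterion.

Variables (m : nat) (RH RK : nat -> nat -> nat -> nat -> bool).
Local Notation n := m.+1.

Definition cycle3_list (a b c : nat) : seq nat :=
  [seq if i == a then b else if i == b then c else if i == c then a else i | i <- iota 0 n].

Lemma preserving_proper R a b c : uniq [:: a; b; c] -> all (fun i => i < n) [:: a; b; c] ->
  ~~ list_preserves m R (cycle3_list a b c) -> preserving m R \proper 'Alt_('I_n).
Proof.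
move=> u /and4P[an bn cn _].
pose f i : 'I_n := inord i.
have uf : uniq [:: f a; f b; f c].
  rewrite -(map_inj_uniq val_inj) /= /f !inordK //.
have gA : cycle3 (f a) (f b) (f c) \in 'Alt_('I_n).
  have /andP[ab ac] : (f a != f b) && (f a != f c).
    by move: uf; rewrite /= !inE negb_or => /andP[].
  by rewrite Alt_even odd_permM !odd_tperm ab ac.
have gE (x : 'I_n) : val (cycle3 (f a) (f b) (f c) x) = nth 0%N (cycle3_list a b c) x.
  rewrite (nth_map 0%N) ?size_iota // nth_iota // add0n.
  have [Ea Eb Ec En] := cycle3E uf.
  have fE i : i < n -> (val x == i) = (x == f i).
    by move=> i_n; rewrite -val_eqE /= inordK.
  rewrite !fE //.
  have [->|xa] := eqVneq x (f a); first by rewrite Ea; apply: inordK.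
  have [->|xb] := eqVneq x (f b); first by rewrite Eb; apply: inordK.
  have [->|xc] := eqVneq x (f c); first by rewrite Ec; apply: inordK.
  by rewrite En // !inE !negb_or xa xb.
rewrite (list_preservesP _ gA gE) => ng; apply/properP; split.
  by apply/subsetP => g /preservingP[].
by exists (cycle3 (f a) (f b) (f c)).
Qed.

Definition swap_list (ts : seq (nat * nat)) (i : nat) : nat :=
  foldl (fun j t => if j == t.1 then t.2 else if j == t.2 then t.1 else j) i ts.

(* An entry [(lam, pi, ts)] of a table writes the cycle type [lam] on the points in the order
   [pi]. The conjugator leading there may be odd; since the swaps [ts] are odd in number and
   also lead to an element of one of the two groups, it can be corrected to an even one. *)
Definition layout_ok (lam pi : seq nat) : bool :=
  let p := lperm_of_cycles n (reshape lam pi) in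
  perm_eq pi (iota 0 n) && (list_preserves m RH p || list_preserves m RK p).

Definition table_ok (e : seq nat * seq nat * seq (nat * nat)) : bool :=
  let: (lam, pi, ts) := e in
  [&& layout_ok lam pi, layout_ok lam (map (swap_list ts) pi),
      odd (size ts) & all (fun t => [&& t.1 < n, t.2 < n & t.1 != t.2]) ts].

(** [k] is the fuel of the recursion; the list is complete once [s <= k]. *)
Fixpoint compositions (k s : nat) : seq (seq nat) :=
  if k is k'.+1 then
    if (s == 0)%N then [:: [::]] else
    flatten [seq [seq l :: lam | lam <- compositions k' (s - l)] | l <- iota 1%N s]
  else [:: [::]].

Lemma mem_compositions k s lam : s <= k -> sumn lam = s -> all (leq 1) lam ->
  lam \in compositions k s.
Proof.
elim: k s lam => [|k IH] s lam sk E.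
  case: lam E => [//|l lam] /= E /andP[l1 _].
  by move: sk; rewrite -E leqn0 addn_eq0; case: l l1 {E}.
case: lam E => [|l lam] /= E; first by rewrite -E.
case/andP=> l1 pos; have -> : (s == 0)%N = false by rewrite -E; case: l l1 {E}.
apply/flattenP; exists [seq l :: mu | mu <- compositions k (s - l)].
  by apply: map_f; rewrite mem_iota l1 -E add1n ltnS leq_addr.
apply: (map_f (cons l)); apply: IH => //; last by rewrite -E addKn.
by rewrite leq_subLR; apply: leq_trans sk _; rewrite -add1n leq_add2r.
Qed.

Definition covering_check (tb : seq (seq nat * seq nat * seq (nat * nat))) : bool :=
  all table_ok tb &&
  all (fun lam => (odd n == odd (size lam)) ==> (sort leq lam \in map (fun e => e.1.1) tb))
    (compositions n n).

(** Conjugation by [w] writes the cycles of [g] into the places given by [pi], which produces the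
    very permutation tested in [layout_ok]. *)
Lemma layout_conj g cs lam pi (w : {perm 'I_n}) : has_cycles g cs -> map size cs = lam ->
    g \in 'Alt_('I_n) -> layout_ok lam pi -> map w (flatten cs) = map (inord : nat -> 'I_n) pi ->
  g ^ w \in preserving m RH \/ g ^ w \in preserving m RK.
Proof.
move=> cyc szs gA /andP[ppi ok] wE.
have gwA : g ^ w \in 'Alt_('I_n) by move: gA; rewrite !Alt_even odd_permJ.
have cw := has_cyclesJ w cyc.
have csE : map (map w) cs = map (map (inord : nat -> 'I_n)) (reshape lam pi).
  have sh : shape (map (map w) cs) = lam.
    by rewrite -szs /shape -map_comp; apply: eq_map => c /=; rewrite size_map.
  by rewrite -[LHS]flattenK -map_flatten wE sh map_reshape.
have ue := enum_uniq 'I_n.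
have se : size (enum 'I_n) <= n by rewrite size_enum_ord.
have sub : {subset flatten (map (map w) cs) <= enum 'I_n} by move=> z; rewrite mem_enum.
have rep := represents_cycles ord0 ue se cw sub.
have lE : map (map (index^~ (enum 'I_n))) (map (map w) cs) = reshape lam pi.
  rewrite csE -map_comp -[RHS]map_id; apply/eq_in_map => c cr /=.
  rewrite -map_comp -[RHS]map_id; apply/eq_in_map => i ic /=.
  have : i \in pi.
    have: i \in flatten (reshape lam pi) by apply/flattenP; exists c.
    rewrite reshapeKr // -szs -/(shape cs) -size_flatten.
    by rewrite -(size_map (inord : nat -> 'I_n)) -wE size_map.
  by rewrite (perm_mem ppi) mem_iota /= add0n => i_n; rewrite index_enum_ord inordK.
rewrite lE in rep; case: rep => _ rep _ _.
have gE (x : 'I_n) : val ((g ^ w) x) = nth 0%N (lperm_of_cycles n (reshape lam pi)) x.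
  have [|pn E] := rep x; first by rewrite size_enum_ord.
  rewrite size_enum_ord in pn; move/(congr1 val): E.
  by rewrite nth_ord_enum /= nth_enum_ord.
by case/orP: ok; rewrite (list_preservesP _ gwA gE); [left|right].
Qed.

Lemma covering_criterion tb a b c :
    covering_check tb -> uniq [:: a; b; c] -> all (fun i => i < n) [:: a; b; c] ->
    ~~ list_preserves m RH (cycle3_list a b c) -> ~~ list_preserves m RK (cycle3_list a b c) ->
  star_star_coverable 'Alt_('I_n)%G.
Proof.
move=> /andP[/allP tok /allP comp] u lt nH nK.
apply/star_star_coverableP; exists (preserving_group m RH), (preserving_group m RK).
split; try exact: (preserving_proper u lt).
move=> g gA; have [cs0 [cyc0 full0 pos0]] := cycle_decomposition g.
(* The keys of the tables are sorted by length. *)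
pose cs := sort (relpre size leq) cs0.
have pcs : perm_eq cs cs0 by rewrite perm_sort.
have [u0 cg0 fx0] := has_cyclesP _ _ cyc0.
have pfl := perm_flatten pcs.
have full : flatten cs =i predT by move=> z; rewrite (perm_mem pfl) full0.
have cyc : has_cycles g cs.
  apply/has_cyclesP; split.
  - by rewrite (perm_uniq pfl).
  - by move=> d; rewrite (perm_mem pcs); apply: cg0.
  - by move=> z; rewrite full.
have ct0 : has_cycle_type g (map size cs0) by exists cs0.
have lamE : map size cs = sort leq (map size cs0) by rewrite sort_map.
have /comp : map size cs0 \in compositions n n.
  by apply: mem_compositions => //; rewrite (sumn_cycle_type ct0) card_ord.
have -> : odd n == odd (size (map size cs0)).
  by move: gA; rewrite Alt_even (odd_cycle_type pos0 ct0) card_ord; case: (odd _); case: (odd _).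
rewrite -lamE => /mapP[[[lam pi] ts] /tok /and4P[ok1 ok2 ots /allP tsn] /= lE].
have ppi : perm_eq pi (iota 0 n) by case/andP: ok1.
have pin i : i \in pi -> i < n by rewrite (perm_mem ppi) mem_iota.
have upi : uniq (map (inord : nat -> 'I_n) pi).
  rewrite map_inj_in_uniq ?(perm_uniq ppi) ?iota_uniq // => i j /pin i_n /pin j_n.
  by move/(congr1 val); rewrite /= !inordK.
have fpi : map (inord : nat -> 'I_n) pi =i predT.
  move=> x; rewrite -[x]inord_val map_f // (perm_mem ppi) mem_iota add0n.
  exact: ltn_ord.
have ucs : uniq (flatten cs) by case/has_cyclesP: cyc.
have [w wE] := perm_of_enumerations ucs upi full fpi.
have [ow|ow] := boolP (odd_perm w); last first.
  by exists w; [rewrite Alt_even|exact: (layout_conj cyc lE gA ok1 wE)].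
pose t : {perm 'I_n} := \prod_(t <- [seq (inord e.1 : 'I_n, inord e.2 : 'I_n) | e <- ts]) tperm t.1 t.2.
exists (w * t).
  rewrite Alt_even odd_permM ow odd_perm_prod ?size_map ?ots //.
  apply/allP => _ /mapP[e /tsn /and3P[e1 e2 e12] ->].
  by rewrite /dpair /= -val_eqE /= !inordK.
apply: (layout_conj cyc lE gA ok2).
have tE i : i < n -> t (inord i) = inord (swap_list ts i).
  rewrite /t; elim: (ts) tsn i => [|e es IH] ltn i i_n; first by rewrite big_nil perm1.
  have /and3P[e1 e2 _] := ltn e (mem_head _ _).
  have fE j k : j < n -> k < n -> ((inord j : 'I_n) == inord k) = (j == k).
    by move=> jn kn; rewrite -val_eqE /= !inordK.
  have tp : tperm (inord e.1) (inord e.2) (inord i : 'I_n)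
      = inord (if i == e.1 then e.2 else if i == e.2 then e.1 else i).
    by rewrite permE /= !fE //; do ?case: ifP.
  rewrite /= big_cons permM tp IH //.
  - by move=> f fes; apply: ltn; rewrite inE fes orbT.
  - by do ?case: ifP.
rewrite -!map_comp (eq_map (permM w t)) (map_comp t w) wE -map_comp.
by apply/eq_in_map => i /pin i_n /=; apply: tE.
Qed.

End Criterion.

(** * The groups and tables for degrees four to eight *)

Definition initial_rel (k : nat) : nat -> nat -> nat -> nat -> bool :=
  fun x _ _ _ => x < k.

Definition halves_rel (k : nat) : nat -> nat -> nat -> nat -> bool :=
  fun x y _ _ => (x < k) == (y < k).

(** The parallelogram relation [x - y = w - z]; the permutations of Z/k preserving it are the affine
    maps. *)
Definition cyclic_affine_rel (k : nat) : nat -> nat -> nat -> nat -> bool :=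
  fun x y z w => x + z == y + w %[mod k].

(* [x + y + z + w = 0] in the vector space of dimension 3 over the field with two
   elements, points being coded in binary. *)
Definition binary_affine_rel : nat -> nat -> nat -> nat -> bool :=
  fun x y z w => [&& ~~ (odd x (+) odd y (+) odd z (+) odd w),
    ~~ (odd x./2 (+) odd y./2 (+) odd z./2 (+) odd w./2)
    & ~~ (odd x./2./2 (+) odd y./2./2 (+) odd z./2./2 (+) odd w./2./2)].

Definition table4 : seq (seq nat * seq nat * seq (nat * nat)) :=
  [:: ([:: 1; 1; 1; 1], [:: 0; 1; 2; 3], [:: (0, 1)]);
     ([:: 1; 3], [:: 0; 1; 2; 3], [:: (1, 2)]);
     ([:: 2; 2], [:: 0; 1; 2; 3], [:: (0, 1)])]%N.

(** The swaps for the 5-cycle compose to multiplication by 2 modulo 5, an odd permutation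
    normalizing the translations. *)
Definition table5 : seq (seq nat * seq nat * seq (nat * nat)) :=
  [:: ([:: 1; 1; 1; 1; 1], [:: 0; 1; 2; 3; 4], [:: (0, 1)]);
     ([:: 1; 1; 3], [:: 0; 1; 2; 3; 4], [:: (0, 1)]);
     ([:: 1; 2; 2], [:: 0; 1; 2; 3; 4], [:: (0, 1)]);
     ([:: 5], [:: 0; 1; 2; 3; 4], [:: (1, 2); (1, 4); (3, 1)])]%N.

(** In the entry for [2,4] the points of each cycle alternate between the two halves. *)
Definition table6 : seq (seq nat * seq nat * seq (nat * nat)) :=
  [:: ([:: 1; 1; 1; 1; 1; 1], [:: 0; 1; 2; 3; 4; 5], [:: (0, 1)]);
     ([:: 1; 1; 1; 3], [:: 0; 1; 2; 3; 4; 5], [:: (0, 1)]);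
     ([:: 1; 1; 2; 2], [:: 0; 1; 2; 3; 4; 5], [:: (0, 1)]);
     ([:: 1; 5], [:: 0; 1; 2; 3; 4; 5], [:: (1, 2)]);
     ([:: 2; 4], [:: 0; 3; 1; 4; 2; 5], [:: (0, 1)]);
     ([:: 3; 3], [:: 0; 1; 2; 3; 4; 5], [:: (0, 1)])]%N.

(** The three swaps [(1, 6)], [(2, 5)], [(3, 4)] compose to [x -> -x] modulo 7; the layout for
    [1,3,3] is multiplication by 2. *)
Definition table7 : seq (seq nat * seq nat * seq (nat * nat)) :=
  [:: ([:: 1; 1; 1; 1; 1; 1; 1], [:: 0; 1; 2; 3; 4; 5; 6], [:: (0, 1)]);
     ([:: 1; 1; 1; 1; 3], [:: 0; 1; 2; 3; 4; 5; 6], [:: (0, 1)]);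
     ([:: 1; 1; 1; 2; 2], [:: 0; 1; 2; 3; 4; 5; 6], [:: (0, 1)]);
     ([:: 1; 1; 5], [:: 0; 1; 2; 3; 4; 5; 6], [:: (0, 1)]);
     ([:: 1; 2; 4], [:: 2; 0; 1; 3; 4; 5; 6], [:: (0, 1)]);
     ([:: 1; 3; 3], [:: 0; 1; 2; 4; 3; 6; 5], [:: (1, 6); (2, 5); (3, 4)]);
     ([:: 2; 2; 3], [:: 0; 1; 2; 3; 4; 5; 6], [:: (0, 1)]);
     ([:: 7], [:: 0; 1; 2; 3; 4; 5; 6], [:: (1, 6); (2, 5); (3, 4)])]%N.

(** The two layouts for [1,7] are multiplication by [x] in the field with 8 elements, with
    [x^3 = x + 1] before the swaps and [x^3 = x^2 + 1] after them. *)
Definition table8 : seq (seq nat * seq nat * seq (nat * nat)) :=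
  [:: ([:: 1; 1; 1; 1; 1; 1; 1; 1], [:: 0; 1; 2; 3; 4; 5; 6; 7], [:: (0, 1)]);
     ([:: 1; 1; 1; 1; 1; 3], [:: 0; 1; 2; 3; 4; 5; 6; 7], [:: (0, 1)]);
     ([:: 1; 1; 1; 1; 2; 2], [:: 0; 1; 2; 3; 4; 5; 6; 7], [:: (0, 1)]);
     ([:: 1; 1; 1; 5], [:: 0; 1; 2; 3; 4; 5; 6; 7], [:: (0, 1)]);
     ([:: 1; 1; 2; 4], [:: 0; 1; 2; 3; 4; 6; 5; 7], [:: (0, 1)]);
     ([:: 1; 1; 3; 3], [:: 0; 1; 2; 4; 6; 3; 5; 7], [:: (0, 1)]);
     ([:: 1; 2; 2; 3], [:: 0; 1; 2; 3; 4; 5; 6; 7], [:: (0, 1)]);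
     ([:: 1; 7], [:: 0; 1; 2; 4; 3; 6; 7; 5], [:: (3, 5); (3, 6); (3, 7)]);
     ([:: 2; 2; 2; 2], [:: 0; 1; 2; 3; 4; 5; 6; 7], [:: (0, 1)]);
     ([:: 2; 6], [:: 0; 1; 2; 4; 6; 3; 5; 7], [:: (0, 1)]);
     ([:: 3; 5], [:: 0; 1; 2; 3; 4; 5; 6; 7], [:: (0, 1)]);
     ([:: 4; 4], [:: 0; 1; 2; 3; 4; 5; 6; 7], [:: (0, 2)])]%N.

(** The three final numbers name a 3-cycle outside both groups. It must not preserve the set of the
    first [k] points, hence [0 1 3] where this set is [0 1 2]. *)
Lemma Alt_coverable n : 4 <= n <= 8 -> star_star_coverable 'Alt_('I_n)%G.
Proof.
case: n => [|[|[|[|[|[|[|[|[|n]]]]]]]]] // _.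
- by apply: (@covering_criterion 3 (initial_rel 1) (halves_rel 2) table4 0 1 2)%N; vm_compute.
- by apply: (@covering_criterion 4 (initial_rel 1) (cyclic_affine_rel 5) table5 0 1 2)%N; vm_compute.
- by apply: (@covering_criterion 5 (initial_rel 1) (halves_rel 3) table6 0 1 3)%N; vm_compute.
- by apply: (@covering_criterion 6 (initial_rel 2) (cyclic_affine_rel 7) table7 0 1 2)%N; vm_compute.
- by apply: (@covering_criterion 7 (initial_rel 3) binary_affine_rel table8 0 1 3)%N; vm_compute.
Qed.

(** The order of A_n is 1 or 3, so proper subgroups are trivial. An element outside all conjugates
    of [H] would lie in a conjugate of [K] and be 1, which is in [H]. *)
Lemma Alt_not_coverable_small n : 0 < n <= 3 -> ~ star_star_coverable 'Alt_('I_n)%G.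
Proof.
move=> n3 /star_star_coverableP[H [K [pH pK cov]]].
have triv (M : {group {perm 'I_n}}) : M \proper 'Alt_('I_n) -> M :=: 1.
  move=> pM; have [n2|n2] := leqP n 2.
    have A1 : 'Alt_('I_n) = 1 by apply: trivial_Alt_2; rewrite card_ord.
    by move: pM; rewrite A1 properE sub1G andbF.
  have T3 : #|'I_n| = 3 by rewrite card_ord; lia.
  have cA : #|'Alt_('I_n)| = 3.
    have T1 : 1 < #|'I_n| by rewrite T3.
    by move: (card_Alt T1); rewrite T3 -[3`!]/(2 * 3)%N => /eqP; rewrite eqn_pmul2l // => /eqP.
  have dM := cardSg (proper_sub pM); have lM := proper_card pM.
  rewrite cA in dM lM; apply: card1_trivg; move: dM lM (cardG_gt0 M).
  by case: #|M| => [|[|[|]]].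
have [x xA nx] := conjugates_do_not_cover pH.
have [g gA [gH|gK]] := cov x xA; first by move: (nx g gA); rewrite gH.
have x1 : x = 1.
  move: gK; rewrite (triv K pK) inE => /eqP E.
  by apply: (conjg_inj g); rewrite E conj1g.
by have := nx 1 (group1 _); rewrite x1 conj1g group1.
Qed.

Theorem theorem3p9 (n : nat) (hn : 1 <= n) :
  star_star_coverable 'Alt_('I_n)%G <-> 4 <= n <= 8.
Proof.
split=> [cov|]; last exact: Alt_coverable.
have [n3|n4] := leqP n 3; first by case: (Alt_not_coverable_small _ cov); rewrite hn.
rewrite /= leqNgt; apply/negP => n9.
have [H [K [pH pK cv]]] := (star_star_coverableP _).1 cov.
exact: (not_covered (card_ord n) n9 (proper_sub pH) (proper_sub pK)
         (proper_subn pH) (proper_subn pK) cv).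
Qed.
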